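(* Let $r\geq k\geq 3$ be fixed integers. Then, as $n\to\infty$, \[S^k_{2r}(n)=\binom{r}{k}\left(\frac{n}{r}\right)^k+\Theta(n^{k-1}).\]
   Context: For an integer $k\geq 3$, a regular $(k-1)$-simplex is a set of $k$ points in Euclidean space whose pairwise distances are all equal. $S^k_d(n)$ denotes the maximum number of regular $(k-1)$-simplices (of any side lengths) spanned by a set of $n$ points in $\mathbb{R}^d$, where a simplex is spanned by a point set if all its vertices lie in the set. Here $\Theta(n^{k-1})$ stands for a positive quantity bounded above and below by positive constants (depending only on $r,k$) times $n^{k-1}$ for all sufficiently large $n$. *)

(* Defs.v *)
From mathcomp Require Export all_boot all_order all_algebra.
From mathcomp Require Export finmap.
From mathcomp Require Export boolp reals.

Set Implicit Arguments.
Unset Strict Implicit.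
Unset Printing Implicit Defensive.

Import Order.TTheory GRing.Theory Num.Theory.
Local Open Scope ring_scope.
Local Open Scope fset_scope.

Section RegularSimplices.
Variables (R : realType) (d : nat).
Implicit Types (x y : 'rV[R]_d) (A B : {fset 'rV[R]_d}).

(* The norm that MathComp-Analysis puts on 'rV[R]_d is the sup norm, hence
   this explicit Euclidean distance. *)
Definition edist x y : R := Num.sqrt (\sum_(i < d) (x 0 i - y 0 i) ^+ 2).

Definition regular_simplex (k : nat) B : Prop :=
  #|` B| = k /\
  exists l : R, forall x y, x \in B -> y \in B -> x != y -> edist x y = l.

Definition num_simplices (k : nat) A : nat :=
  #|` [fset B in fpowerset A | `[< regular_simplex k B >]]|.

(* S^k_d(n). A set of n points has only 'C(n, k) subsets of size k, so the
   bound on m excludes no attained value; see num_simplices_le_max and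
   max_simplices_attained. *)
Definition max_simplices (k n : nat) : nat :=
  (\max_(m < 'C(n, k).+1 |
         `[< exists A, #|` A| = n /\ num_simplices k A = m >]) m)%N.

Lemma num_simplices_bin (k : nat) A : (num_simplices k A <= 'C(#|` A|, k))%N.
Proof.
rewrite /num_simplices; set S := [fset B in _ | _].
have SP B : B \in S -> B `<=` A /\ #|` B| = k.
  by rewrite !inE /= fpowersetE => /andP[-> /asboolP[]].
rewrite (cardfE A) -card_draws cardE -(size_map (fsub A) S); apply: uniq_leq_size.
  rewrite map_inj_in_uniq ?fset_uniq // => B C /SP[sB _] /SP[sC _]; exact: fsub_inj.
by move=> _ /mapP[B /SP[sB cB] ->]; rewrite mem_enum inE card_fsub // cB.
Qed.

Lemma num_simplices_le_max (k n : nat) A :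
  #|` A| = n -> (num_simplices k A <= max_simplices k n)%N.
Proof.
move=> cA; have ltA : (num_simplices k A < 'C(n, k).+1)%N.
  by rewrite ltnS -cA num_simplices_bin.
apply: (bigop.bigmax_sup (Ordinal ltA)) => //; by apply/asboolP; exists A.
Qed.

Lemma max_simplices_attained (k n : nat) A :
  #|` A| = n ->
  exists2 B, #|` B| = n & num_simplices k B = max_simplices k n.
Proof.
move=> cA; rewrite /max_simplices.
set P := (X in \max_(m < _ | X m) _).
have ltA : (num_simplices k A < 'C(n, k).+1)%N.
  by rewrite ltnS -cA num_simplices_bin.
have [|m Pm ->] := @eq_bigmax_cond _ P (@nat_of_ord _).
  by apply/card_gt0P; exists (Ordinal ltA); apply/asboolP; exists A.
by move: Pm => /asboolP[B [cB nB]]; exists B.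
Qed.

End RegularSimplices.

Arguments edist {R d} x y.
Arguments regular_simplex {R d} k B.
Arguments num_simplices {R d} k A.
Arguments max_simplices R d k n : clear implicits.

(* Main.v *)
Require Import Defs.
From mathcomp Require Import all_boot all_order all_algebra finmap boolp reals.
From mathcomp Require Import mathcomp_extra unstable zify ring lra.

Set Implicit Arguments.
Unset Strict Implicit.
Unset Printing Implicit Defensive.

Import Order.TTheory GRing.Theory Num.Theory.
Local Open Scope ring_scope.

(** Call r circles Lenz circles when they have a common centre and a common
    radius and lie in r pairwise orthogonal planes of R^(2r).  Points of
    different Lenz circles are at the same distance, the radius times the
    square root of 2, so every k points taken on k different circles form a
    regular simplex.

    Lower bound.  Spreading n points evenly over the circles gives
    C(r, k) (n/r)^k simplices up to O(n^(k-2)).  If the points of one circle are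
    moreover paired at right angles, every pair together with k - 2 points of
    other circles is a regular simplex as well, and there are of the order of
    n^(k-1) of these ([lenz_simplices], [max_simplices_lower]).

    Upper bound.  Write k = q + 1, r = m + 1 and
    phi = C(m, q) / r^q, so that phi n^q is the derivative of
    C(r, k) (n/r)^k.  If some point lies in fewer than (phi - eps) n^q simplices,
    it can be removed and induction on n applies ([simplices_upper]).
    Otherwise all points but at most one lie on Lenz circles
    ([circles_structure]), and then a direct count suffices
    ([simplices_on_circles]): by Zykov's theorem at most C(r, k) (n/r)^k simplices
    have their vertices on different circles, while in a simplex with two
    vertices x, y on one circle the other vertices determine the side, hence
    leave at most two choices for y, so that there are only O(n^(k-1)) of them.

    The structure under the minimum degree condition comes as follows.

    1. Call a pair of points heavy if it is the side of at least a fixed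
       proportion of n equilateral triangles.  All but few simplices are cliques
       of the graph of heavy pairs, which by the Moon-Moser inequalities contains
       a positive proportion of all r-cliques, as there are more simplices than
       r - 1 classes could carry ([clique_supersaturation]).  A box argument
       turns them into r classes T_1, .., T_r of t points each, where the distance
       between a point of T_a and a point of T_b depends on a and b only
       ([classes_exist]).  The two legs of an equilateral triangle over a heavy
       pair are what makes these distances constant.
    2. In R^(2r) such classes lie on circles in r orthogonal planes with a
       common centre, which yields coordinates adapted to the classes
       ([frame_exists], [planar_circles]).  These coordinates are the only geometric
       input.  A point whose component in the plane of a circle is not zero is at a
       given distance from at most two points of that circle ([circle_meet]).
    3. Take the simplices through a point u of T_a, and let u run through
       T_a.  By 2, all but O(n^q) of the opposite facets belong to at most two
       such points, or consist of points orthogonal to the plane of T_a forming a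
       clique of an explicit graph ([degree_sum]).  This graph contains
       no r classes of three points, which together with T_a would be one class
       too many for R^(2r), so the number of its cliques is at most that of
       the (r - 1)-partite Turan graph ([perp_cliques_upper]).  As the degrees are
       large, at least about m n / r points are orthogonal to plane a, for every a.
       Therefore almost all points lie in the planes, and then almost all of
       them on circles of one radius ([nonplanar_few], [off_circles_few]).
    4. A point off these circles that is not the centre is orthogonal to at most
       r - 2 planes of circles on which it has many neighbours, and thus has a
       degree below the assumed minimum ([degree_off_circles],
       [all_on_circles]). *)

(** * Counting cliques: the Moon-Moser inequality *)

Section Cliques.
Variables (V : finType) (e : rel V).
Hypothesis e_sym : symmetric e.
Implicit Types (Q R Z : {set V}).

Definition is_clique Q := [forall x in Q, forall y in Q, (x != y) ==> e x y].

Lemma is_cliqueP Q :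
  reflect {in Q &, forall x y, x != y -> e x y} (is_clique Q).
Proof.
apply: (iffP forall_inP) => [h x y xQ yQ xy|h x xQ].
  by move/forall_inP: (h x xQ) => /(_ y yQ) /implyP; apply.
by apply/forall_inP => y yQ; apply/implyP => xy; exact: h.
Qed.

Definition cliques Z s :=
  [set Q : {set V} | [&& Q \subset Z, #|Q| == s & is_clique Q]].

Definition extensions Z R :=
  [set y in Z | (y \notin R) && [forall x in R, e x y]].

Lemma extensionsP Z R y :
  reflect [/\ y \in Z, y \notin R & {in R, forall x, e x y}]
          (y \in extensions Z R).
Proof.
rewrite inE; apply: (iffP and3P) => -[yZ yR h]; split => //.
  by move=> x xR; move/forall_inP: h; apply.
by apply/forall_inP.
Qed.

(** Removing a vertex from a clique and adding a common neighbour to a clique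
    are inverse operations; both sides sum over the same flags. *)
Lemma clique_flags Z s (F : {set V} -> nat) :
  (\sum_(Q in cliques Z s.+1) \sum_(x in Q) F (Q :\ x) =
   \sum_(R in cliques Z s) \sum_(x in extensions Z R) F R)%N.
Proof.
rewrite !pair_big_dep /=.
rewrite (reindex_onto (fun p : {set V} * V => (p.2 |: p.1, p.2))
                      (fun p => (p.1 :\ p.2, p.2))) /=; last first.
  by move=> [Q x] /= /andP[_ xQ]; rewrite setD1K.
apply: eq_big => [[R x] /=|[R x] /=]; last first.
  by move=> /andP[_ /eqP[->]].
rewrite setU11 andbT xpair_eqE eqxx andbT.
have [xR|xR] := boolP (x \in R).
  rewrite (_ : _ \in extensions _ _ = false) ?andbF; last first.
    by apply/negP => /extensionsP[]; rewrite xR.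
  by apply/negP => /andP[_ /eqP E]; move: xR; rewrite -E setD11.
rewrite setU1K // eqxx andbT !inE subUset sub1set cardsU1 xR eqSS.
apply/andP/andP => [[/andP[xZ RZ] /andP[cR /is_cliqueP cl]]|].
  split; last first.
    rewrite xZ /=; apply/forall_inP => y yR; apply: cl; rewrite ?setU11 ?setU1r //.
    by apply: contraNneq xR => <-.
  rewrite RZ cR; apply/is_cliqueP => y z yR zR; apply: cl; exact: setU1r.
move=> [/and3P[RZ cR /is_cliqueP cl] /andP[xZ /forall_inP h]].
rewrite xZ RZ cR; split=> //; apply/is_cliqueP => y z.
move=> /setU1P[->|yR] /setU1P[->|zR] yz; first by rewrite eqxx in yz.
- by rewrite e_sym; exact: h.
- exact: h.
- exact: cl.
Qed.

Lemma clique_extensions Z s :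
  (s.+1 * #|cliques Z s.+1| = \sum_(R in cliques Z s) #|extensions Z R|)%N.
Proof.
have := clique_flags Z s (fun=> 1%N).
under [in RHS]eq_bigr do rewrite sum1_card.
move=> <-; rewrite -sum1_card big_distrr /=; apply: eq_bigr => Q.
by rewrite inE sum1_card => /and3P[_ /eqP-> _]; rewrite muln1.
Qed.

(** A vertex y that extends Q extends all the sets Q :\ x; any other vertex extends
    at most one of them, as x must be y itself or the only non-neighbour of y. *)
Lemma extensions_drop Z Q :
  (\sum_(x in Q) #|extensions Z (Q :\ x)| + #|extensions Z Q|
     <= #|Z| + #|Q| * #|extensions Z Q|)%N.
Proof.
have card_sum (A : {set V}) : A \subset Z -> (#|A| = \sum_(y in Z) (y \in A))%N.
  move=> AZ; rewrite -sum1_card big_mkcond [in RHS]big_mkcond /=.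
  apply: eq_bigr => y _; case: ifP => [yA|_]; last by case: ifP.
  by rewrite (subsetP AZ).
have extZ R : extensions Z R \subset Z by apply/subsetP => y /extensionsP[].
under eq_bigr do rewrite card_sum //.
rewrite exchange_big (card_sum (extensions Z Q)) // -big_split -sum1_card.
rewrite big_distrr -big_split /=; apply: leq_sum => y yZ.
have [yQ|yQ] := boolP (y \in extensions Z Q).
  rewrite addnC leq_add2l; rewrite -sum1_card big_distrl /=; apply: leq_sum => x _.
  by case: (_ \in _).
rewrite addn0 muln0 addn0.
have [x0 hx0] : exists x0, {in Q, forall x, y \in extensions Z (Q :\ x) -> x = x0}.
  have [yQ'|yQ'] := boolP (y \in Q).
    exists y => x xQ /extensionsP[_ + _]; rewrite !inE yQ' andbT negbK.
    by move/eqP.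
  have /forall_inPn[x0 x0Q nx0] : ~~ [forall x in Q, e x y].
    by apply: contraNN yQ => h; rewrite inE yZ yQ'.
  exists x0 => x xQ /extensionsP[_ _ h]; apply/eqP; rewrite eq_sym.
  by apply: contraNT nx0 => x0x; apply: h; rewrite !inE x0x.
rewrite (bigID (pred1 x0)) /= [X in (_ + X)%N]big1 ?addn0; last first.
  move=> x /andP[xQ xx0]; case: (boolP (y \in _)) => // /(hx0 _ xQ) xE.
  by rewrite xE eqxx in xx0.
rewrite big_mkcondl /= big_pred1_eq; by case: ifP => // _; case: (_ \in _).
Qed.

Lemma sqr_sum_leq (I : finType) (A : {set I}) (d : I -> nat) :
  ((\sum_(i in A) d i) ^ 2 <= #|A| * \sum_(i in A) d i ^ 2)%N.
Proof.
rewrite -(leq_pmul2l (isT : 0 < 2)%N) -mulnn big_distrlr /=.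
have -> : (2 * (#|A| * \sum_(i in A) d i ^ 2) =
   \sum_(i in A) \sum_(j in A) (d i ^ 2 + d j ^ 2))%N.
  under [RHS]eq_bigr do rewrite big_split /= sum_nat_const.
  by rewrite big_split /= sum_nat_const -big_distrr /= mul2n addnn.
rewrite big_distrr /=; apply: leq_sum => i _; rewrite big_distrr /=.
by apply: leq_sum => j _; have [] := nat_Cauchy (d i) (d j).
Qed.

(** Summing [extensions_drop] over the cliques of rank s + 1 bounds the sum of the
    squared numbers of extensions of the cliques of rank s, and Cauchy-Schwarz
    bounds it from below. *)
Lemma moon_moser Z s :
  ((s.+1 * #|cliques Z s.+1|) ^ 2 <=
   #|cliques Z s| * (s * (s.+2 * #|cliques Z s.+2|) + #|Z| * #|cliques Z s.+1|))%N.
Proof.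
rewrite clique_extensions (leq_trans (sqr_sum_leq _ _)) // leq_mul2l.
apply/orP; right; have := clique_flags Z s (fun R => #|extensions Z R|).
under [in RHS]eq_bigr do rewrite sum_nat_const mulnn.
move=> <-; rewrite clique_extensions.
have -> : (#|Z| * #|cliques Z s.+1| = \sum_(Q in cliques Z s.+1) #|Z|)%N.
  by rewrite sum_nat_const mulnC.
rewrite big_distrr -big_split /=; apply: leq_sum => Q.
rewrite inE => /and3P[_ /eqP cQ _].
by have := extensions_drop Z Q; rewrite cQ mulSn; lia.
Qed.

Lemma cliques0 Z : #|cliques Z 0| = 1%N.
Proof.
rewrite (_ : cliques Z 0 = [set set0]) ?cards1 //.
apply/setP => Q; rewrite !inE cards_eq0; apply/and3P/eqP => [[_ /eqP-> _]//|->].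
by rewrite sub0set eqxx; split=> //; apply/is_cliqueP => x; rewrite inE.
Qed.

Lemma cliquesS_leq Z s : (s.+1 * #|cliques Z s.+1| <= #|Z| * #|cliques Z s|)%N.
Proof.
rewrite clique_extensions mulnC -sum_nat_const; apply: leq_sum => R _.
by apply: subset_leq_card; apply/subsetP => y /extensionsP[].
Qed.

Lemma cliques_leq Z s t :
  (#|cliques Z (s + t)| <= #|cliques Z s| * #|Z| ^ t)%N.
Proof.
elim: t => [|t IH]; first by rewrite addn0 muln1.
rewrite addnS expnS mulnCA.
apply: leq_trans (leq_mul (leqnn _) IH); apply: leq_trans (cliquesS_leq _ _).
by rewrite leq_pmull.
Qed.

Lemma cliquesE_leq Z s : (#|cliques Z s| <= #|Z| ^ s)%N.
Proof. by have := cliques_leq Z 0 s; rewrite cliques0 mul1n. Qed.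

End Cliques.

(** * Clique densities *)

Section CliqueDensity.
Variables (R : realFieldType) (V : finType) (e : rel V) (Z : {set V}).
Hypothesis e_sym : symmetric e.
Let K s : R := #|cliques e Z s|%:R.
Let n : R := #|Z|%:R.

(** For th = 1/m, the number 1 - s * th is the value of (s + 1) K (s + 1) / (n K s) in
    the balanced m-partite graph on n vertices.  By the Moon-Moser inequality, a graph
    that exceeds this value at one rank exceeds it at all later ones. *)
Lemma clique_ratio_step (th : R) s :
  (0 < s)%N -> 0 <= 1 - s%:R * th ->
  n * K s * (1 - s%:R * th) < s.+1%:R * K s.+1 ->
  n * K s.+1 * (1 - s.+1%:R * th) < s.+2%:R * K s.+2.
Proof.
move=> s_gt0 th_s h.
have K0 t : 0 <= K t by rewrite ler0n.
have n0 : 0 <= n by rewrite ler0n.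
have S1 : s.+1%:R = s%:R + 1 :> R by rewrite -natr1.
have S2 : s.+2%:R = s%:R + 2 :> R by rewrite -[in LHS]addn2 natrD.
have sR : 0 < s%:R :> R by rewrite ltr0n.
have MM : (s.+1%:R * K s.+1) ^+ 2 <=
    K s * (s%:R * (s.+2%:R * K s.+2) + n * K s.+1).
  by have := moon_moser e_sym Z s; rewrite -(ler_nat R) natrX !natrM !natrD !natrM.
have b_gt0 : 0 < s.+1%:R * K s.+1.
  by apply: le_lt_trans h; rewrite !mulr_ge0.
have b1 : 0 < K s.+1 by move: b_gt0; rewrite pmulr_rgt0 // ltr0n.
have a_gt0 : 0 < K s.
  rewrite lt0r K0 andbT; apply/eqP => a0; move: MM; rewrite a0 mul0r.
  by rewrite leNgt exprn_gt0.
rewrite -(ltr_pM2l (mulr_gt0 a_gt0 sR)).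
have -> : K s * s%:R * (s.+2%:R * K s.+2) =
   K s * (s%:R * (s.+2%:R * K s.+2) + n * K s.+1) - K s * n * K s.+1 by ring.
apply: lt_le_trans (lerB MM (lexx _)).
rewrite -subr_gt0.
have -> : (s.+1%:R * K s.+1) ^+ 2 - K s * n * K s.+1 -
   K s * s%:R * (n * K s.+1 * (1 - s.+1%:R * th)) =
   s.+1%:R * K s.+1 * (s.+1%:R * K s.+1 - n * K s * (1 - s%:R * th)).
  by rewrite S1; ring.
by rewrite mulr_gt0 // subr_gt0.
Qed.

Lemma clique_ratio_chain (th : R) s j :
  (0 < s)%N -> (s <= j)%N -> (forall i, (i <= j)%N -> 0 <= 1 - i%:R * th) ->
  n * K s * (1 - s%:R * th) < s.+1%:R * K s.+1 ->
  n * K j * (1 - j%:R * th) < j.+1%:R * K j.+1.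
Proof.
move=> s0 /subnKC <-; elim: (j - s)%N => [|i IH]; first by rewrite addn0.
rewrite addnS => thj h; apply: clique_ratio_step; first by rewrite addn_gt0 s0.
  by apply: thj; exact: leqnSn.
by apply: IH h => i' hi'; apply: thj; exact: leqW.
Qed.

End CliqueDensity.

Section CliqueBounds.
Variables (R : realFieldType) (V : finType) (e : rel V) (Z : {set V}).
Hypothesis e_sym : symmetric e.
Let K s : R := #|cliques e Z s|%:R.
Let n : R := #|Z|%:R.

(** The clique counts of the balanced m-partite graph on x vertices satisfy the
    extremal recurrence. *)
Lemma turan_density_step m s (x : R) : (0 < m)%N -> (s <= m)%N ->
  'C(m, s)%:R * (x / m%:R) ^+ s * (x * (1 - s%:R / m%:R)) =
  s.+1%:R * ('C(m, s.+1)%:R * (x / m%:R) ^+ s.+1).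
Proof.
move=> m0 sm; have mR : m%:R != 0 :> R by rewrite pnatr_eq0 -lt0n.
rewrite [RHS]mulrA -natrM mul_bin_left natrM natrB // exprS.
by field.
Qed.

(** If a ratio exceeded that of the Turan graph, it would still do so at rank m,
    where that ratio is 0, and there would be a clique of rank m + 1. *)
Lemma zykov m k :
  (0 < m)%N -> (k <= m.+1)%N -> #|cliques e Z m.+1| = 0%N ->
  K k <= 'C(m, k)%:R * (n / m%:R) ^+ k.
Proof.
move=> m0 km Km0; have mR : 0 < m%:R :> R by rewrite ltr0n.
have n0 : 0 <= n by rewrite ler0n.
elim: k km => [|s IH]; first by rewrite /K cliques0 bin0 mulr1.
rewrite ltnS => sm; have {}IH := IH (leqW sm).
rewrite -(ler_pM2l (ltr0Sn R s)) -turan_density_step //.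
have fac0 : 0 <= 1 - s%:R / m%:R :> R.
  by rewrite subr_ge0 ler_pdivrMr // mul1r ler_nat.
apply: (@le_trans _ _ (n * K s * (1 - s%:R / m%:R))); last first.
  rewrite mulrA ler_wpM2r // mulrC ler_wpM2r //.
have [s0|s0] := posnP s.
  rewrite s0 /K cliques0 mul1r mul0r subr0 !mulr1 ler_nat.
  by have := cliquesE_leq e_sym Z 1; rewrite expn1.
rewrite leNgt; apply/negP => viol.
have := @clique_ratio_chain R _ _ Z e_sym m%:R^-1 s m s0 sm.
rewrite mulfV ?gt_eqF // subrr mulr0 Km0 mulr0 ltxx => h; apply: notF; apply: h => //.
move=> i im; rewrite subr_ge0 ler_pdivrMr // mul1r ler_nat //.
Qed.

(** Here the threshold is th = 1/m - eta: without a violation the counts stay close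
    to those of the Turan graph, and a violation leaves a ratio of at least eta at
    each of the later ranks up to m. *)
Lemma clique_supersaturation m k (eps eta : R) :
  (0 < m)%N -> (k <= m.+1)%N -> 0 < eps -> 0 < eta <= 1 -> k%:R * eta <= eps ->
  ('C(m, k)%:R / m%:R ^+ k + eps) * n ^+ k < K k ->
  eps * (eta / m.+1%:R) ^+ m.+1 * n ^+ m.+1 <= K m.+1.
Proof.
move=> m0 km eps0 /andP[eta0 eta1] keta hk.
have mR : 0 < m%:R :> R by rewrite ltr0n.
have m1R : 0 < m.+1%:R :> R by rewrite ltr0n.
have n0 : 0 <= n by rewrite ler0n.
have K0 s : 0 <= K s by rewrite ler0n.
have Kn s : K s <= n ^+ s.
  by rewrite /K /n -natrX ler_nat; exact: cliquesE_leq.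
have fac0 s : (s <= m)%N -> 0 <= 1 - s%:R / m%:R :> R.
  by move=> sm; rewrite subr_ge0 ler_pdivrMr // mul1r ler_nat.
pose th := m%:R^-1 - eta.
have thE (s : nat) : 1 - s%:R * th = 1 - s%:R / m%:R + s%:R * eta.
  by rewrite /th mulrBr opprB addrA addrAC.
have th_ge (s : nat) : (s <= m)%N -> 0 <= 1 - s%:R * th.
  by move=> sm; rewrite thE addr_ge0 ?fac0 // mulr_ge0 // ltW.
(* Otherwise the error in the density grows by at most eta at each rank. *)
have [s [s0 sk viol]] : exists s, [/\ (0 < s)%N, (s < k)%N &
    n * K s * (1 - s%:R * th) < s.+1%:R * K s.+1].
  apply: contrapT => noviol.
  suff bound s : (s <= k)%N ->
      K s <= ('C(m, s)%:R / m%:R ^+ s + s%:R * eta) * n ^+ s.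
    have := lt_le_trans hk (bound k (leqnn _)); rewrite ltNge ler_wpM2r ?exprn_ge0 //.
    by rewrite lerD2l.
  elim: s => [|s IH] sk.
    by rewrite /K cliques0 bin0 !expr0 mul0r addr0 divr1 mulr1.
  have sm : (s <= m)%N by rewrite -ltnS; exact: leq_trans km.
  have {}IH := IH (ltnW sk).
  have ratio : s.+1%:R * K s.+1 <= n * K s * (1 - s%:R * th).
    have [s0|s0] := posnP s.
      rewrite s0 /K cliques0 mul1r mul0r subr0 !mulr1 ler_nat.
      by have := cliquesE_leq e_sym Z 1; rewrite expn1.
    rewrite leNgt; apply/negP => viol; apply: noviol; exists s; split => //.
  have S0 := ltr0Sn R s.
  rewrite -(ler_pM2l S0); apply: le_trans ratio _; rewrite thE.
  have step := turan_density_step n m0 sm; rewrite !expr_div_n in step.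
  rewrite [leRHS]mulrA [X in _ <= X * _]mulrDr [leRHS]mulrDl.
  have -> : s.+1%:R * ('C(m, s.+1)%:R / m%:R ^+ s.+1) * n ^+ s.+1 =
     'C(m, s)%:R * (n ^+ s / m%:R ^+ s) * (n * (1 - s%:R / m%:R)).
    by rewrite step; ring.
  rewrite mulrDr.
  have A1 : n * K s * (1 - s%:R / m%:R) <=
     'C(m, s)%:R * (n ^+ s / m%:R ^+ s) * (n * (1 - s%:R / m%:R)) +
       s%:R * eta * n ^+ s.+1.
    rewrite exprS.
    apply: le_trans (_ : n * (('C(m, s)%:R / m%:R ^+ s + s%:R * eta) * n ^+ s) *
      (1 - s%:R / m%:R) <= _).
      by rewrite ler_wpM2r ?fac0 // ler_wpM2l.
    rewrite -subr_ge0.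
    rewrite [leRHS](_ : _ = s%:R * eta * (n * n ^+ s) * (s%:R / m%:R)).
      by rewrite !mulr_ge0 ?exprn_ge0 ?invr_ge0 // ltW.
    ring.
  have A2 : n * K s * (s%:R * eta) <= s%:R * eta * n ^+ s.+1.
    rewrite exprS [leRHS]mulrC ler_wpM2r ?mulr_ge0 ?(ltW eta0) //.
    by apply: ler_wpM2l.
  apply: le_trans (lerD A1 A2) _; rewrite -addrA lerD2l -mulrDl -mulrDl.
  rewrite ler_wpM2r ?exprn_ge0 // mulrA ler_wpM2r ?(ltW eta0) //.
  rewrite -natrD -natrM ler_nat; nia.
have sm : (s <= m)%N by rewrite -ltnS; exact: leq_trans sk km.
have lt0Kk : eps * n ^+ k < K k.
  apply: le_lt_trans hk; rewrite ler_wpM2r ?exprn_ge0 // lerDr.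
  by rewrite divr_ge0 ?exprn_ge0 ?ler0n.
have n_gt0 : 0 < n.
  rewrite lt0r n0 andbT; apply/eqP => nE.
  have := lt_le_trans lt0Kk (Kn k).
  by rewrite nE expr0n gtn_eqF ?(leq_ltn_trans _ sk) // mulr0 ltxx.
have Ks : eps * n ^+ s <= K s.
  rewrite -(ler_pM2r (exprn_gt0 (k - s) n_gt0)) -mulrA -exprD subnKC ?(ltnW sk) //.
  apply: le_trans (ltW lt0Kk) _; rewrite /K /n -natrX -natrM ler_nat.
  by have := cliques_leq e_sym Z s (k - s); rewrite subnKC // ltnW.
pose x := eta / m.+1%:R.
have x0 : 0 <= x by rewrite divr_ge0 ?ltW.
have x1 : x <= 1.
  by rewrite ler_pdivrMr // mul1r; apply: le_trans eta1 _; rewrite ler1n.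
have grow i : (s + i <= m.+1)%N -> (x * n) ^+ i * K s <= K (s + i)%N.
  elim: i => [|i IH]; first by rewrite addn0 mul1r.
  rewrite addnS => sim; have {}IH := IH (ltnW sim).
  have sim' : (s + i <= m)%N by rewrite -ltnS.
  have h := @clique_ratio_chain R _ _ Z e_sym th s (s + i) s0 (leq_addr _ _)
    (fun j hj => th_ge j (leq_trans hj sim')) viol.
  rewrite exprS -mulrA; apply: le_trans (_ : x * n * K (s + i)%N <= _).
    by apply: ler_wpM2l => //; rewrite mulr_ge0.
  rewrite /x -(ler_pM2l m1R).
  have -> : m.+1%:R * (eta / m.+1%:R * n * K (s + i)%N) = n * K (s + i)%N * eta.
    by rewrite -!mulrA mulrCA mulVKf ?gt_eqF //; ring.
  apply: le_trans (_ : (s + i).+1%:R * K (s + i).+1 <= _); last first.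
    by rewrite ler_wpM2r // ler_nat.
  apply: le_trans (ltW h); rewrite ler_wpM2l ?mulr_ge0 // thE.
  rewrite -[leLHS]add0r lerD ?fac0 // ler_peMl ?(ltW eta0) // ler1n.
  by rewrite addn_gt0 s0.
have := grow (m.+1 - s)%N; rewrite subnKC ?(leqW sm) // => /(_ (leqnn _)).
rewrite -[eps * _ * _]mulrA -/x exprMn -[x ^+ (_ - _) * _ * _]mulrA; apply: le_trans.
apply: le_trans (_ : x ^+ m.+1 * (n ^+ (m.+1 - s) * (eps * n ^+ s)) <= _).
  rewrite [n ^+ _ * _]mulrCA -exprD subnK ?(leqW sm) //.
  by rewrite mulrCA.
apply: ler_pM; first by rewrite exprn_ge0.
- by rewrite !mulr_ge0 ?exprn_ge0 // ltW.
- by rewrite ler_wiXn2l // leq_subr.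
by rewrite ler_wpM2l // exprn_ge0.
Qed.
End CliqueBounds.

(** * Boxes in dense relations *)

Lemma subset_of_card (V : finType) (X : {set V}) t :
  (t <= #|X|)%N -> exists2 Y : {set V}, Y \subset X & #|Y| = t.
Proof.
move=> tX; have /card_gt0P[Y] : (0 < #|[set Y : {set V} | Y \subset X & #|Y| == t]|)%N.
  by rewrite cards_draws bin_gt0.
by rewrite inE => /andP[YX /eqP]; exists Y.
Qed.

Lemma card_tuple_cons (V : finType) s (P : pred (s.+1.-tuple V)) :
  (#|[set u | P u]| = \sum_x #|[set y : s.-tuple V | P [tuple of x :: y]]|)%N.
Proof.
rewrite -sum1dep_card.
under [RHS]eq_bigr do rewrite -sum1dep_card.
rewrite pair_big_dep /=.
rewrite (reindex (fun p : V * s.-tuple V => [tuple of p.1 :: p.2])) //=.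
exists (fun u => (thead u, [tuple of behead u])) => [[x y] _|u _] /=.
  by congr (_, _); apply: val_inj.
by rewrite -tuple_eta.
Qed.

Lemma upper_nat (R : realType) (x : R) : exists N : nat, forall n, (N <= n)%N -> x <= n%:R.
Proof.
exists (Num.Def.archi_bound x) => n Nn; apply: le_trans (ltW (ltr_bound x)) _.
by rewrite ler_nat.
Qed.

(** Erdos' theorem on complete s-partite subgraphs.  Many first coordinates x have a
    dense cone of tuples y with (x, y) in P.  Fix m of them: most tuples see at least
    t of these m, and by the pigeonhole principle a proportion of at least 2^-m sees
    exactly the same ones, to which the induction hypothesis applies. *)
Lemma box_lemma (R : realType) s t (eps : R) : 0 < eps ->
  exists N, forall V : finType, (N <= #|V|)%N -> forall P : pred (s.-tuple V),
    eps * #|V|%:R ^+ s <= #|[set u | P u]|%:R ->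
    exists W : nat -> {set V}, (forall i, (i < s)%N -> #|W i| = t) /\
      forall u : s.-tuple V, (forall i, tnth u i \in W i) -> P u.
Proof.
elim: s eps => [|s IH] eps eps0.
  exists 0%N => V _ P; rewrite mulr1 => hP; exists (fun=> set0); split => // u _.
  have : 0 < #|[set u | P u]|%:R :> R by exact: lt_le_trans hP.
  by rewrite ltr0n => /card_gt0P[v]; rewrite inE (tuple0 u) (tuple0 v).
(* With m >= 4 t / eps, the tuples that see fewer than t of the m chosen points
   account for at most half of the incidences. *)
have [m mP] := upper_nat (Num.max 1 (4 * t%:R / eps)).
have {mP} := mP m (leqnn _); rewrite ge_max => /andP[m1 mt].
have m0 : 0 < m%:R :> R by exact: lt_le_trans m1.
have mt' : t%:R <= m%:R * eps / 4.
  by move: mt; rewrite ler_pdivrMr //; lra.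
pose eps' := eps / 4 / 2 ^+ m.
have eps'0 : 0 < eps' by rewrite !divr_gt0 ?exprn_gt0.
have [N1 N1P] := IH eps' eps'0.
have [N2 N2P] := upper_nat (m%:R * 2 / eps).
exists (maxn 1 (maxn N1 N2)) => V; rewrite !geq_max => /and3P[V1 VN1 VN2] P hP.
pose n : R := #|V|%:R.
have n0 : 0 < n by rewrite ltr0n.
have ns0 : 0 < n ^+ s by rewrite exprn_gt0.
have nm : m%:R <= n * eps / 2.
  by have := N2P _ VN2; rewrite ler_pdivrMr // -/n; lra.
pose cone x := [set y : s.-tuple V | P [tuple of x :: y]].
have cone_le x : #|cone x|%:R <= n ^+ s.
  by rewrite -natrX ler_nat -card_tuple max_card.
pose D := [set x | eps / 2 * n ^+ s <= #|cone x|%:R].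
have cD : (m <= #|D|)%N.
  rewrite -(ler_nat R); apply: le_trans nm _; rewrite -(ler_pM2r ns0).
  move: hP; rewrite card_tuple_cons natr_sum (bigID (mem D)) /= exprS -/n => hP.
  have h1 : \sum_(x in D) #|cone x|%:R <= #|D|%:R * n ^+ s.
    by rewrite mulr_natl -sumr_const; exact: ler_sum.
  have h2 : \sum_(x | x \notin D) #|cone x|%:R <= n * (eps / 2 * n ^+ s).
    apply: le_trans (_ : \sum_(x | x \notin D) (eps / 2 * n ^+ s) <= _).
      by apply: ler_sum => x; rewrite inE -ltNge => /ltW.
    rewrite sumr_const -[leLHS]mulr_natl ler_wpM2r ?ler_nat ?max_card //.
    by rewrite mulr_ge0 ?ltW // divr_gt0.
  have := le_trans hP (lerD h1 h2); lra.
have [U UD cU] := subset_of_card cD.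
pose trace y := [set x in U | y \in cone x].
pose G := [set y | (t <= #|trace y|)%N].
have cG : eps / 4 * n ^+ s <= #|G|%:R.
  rewrite -(ler_pM2l m0).
  have h0 : m%:R * (eps / 2 * n ^+ s) <= \sum_(x in U) #|cone x|%:R.
    rewrite mulr_natl -cU -sumr_const; apply: ler_sum => x xU.
    by have := subsetP UD _ xU; rewrite inE.
  have swap : \sum_(x in U) #|cone x|%:R = \sum_y #|trace y|%:R :> R.
    rewrite -!natr_sum; congr (_%:R).
    under eq_bigr do rewrite -sum1_card big_mkcond.
    rewrite exchange_big; apply: eq_bigr => y _ /=.
    by rewrite -big_mkcondr /= -sum1dep_card.
  move: h0; rewrite swap (bigID (mem G)) /= => h0.
  have h1 : \sum_(y in G) #|trace y|%:R <= m%:R * #|G|%:R :> R.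
    rewrite mulr_natr -sumr_const; apply: ler_sum => y _; rewrite ler_nat -cU.
    by apply: subset_leq_card; apply/subsetP => x; rewrite inE => /andP[].
  have h2 : \sum_(y | y \notin G) #|trace y|%:R <= t%:R * n ^+ s.
    apply: le_trans (_ : \sum_(y : s.-tuple V | y \notin G) t%:R <= _).
      by apply: ler_sum => y; rewrite inE -ltnNge ler_nat => /ltnW.
    rewrite sumr_const -[leLHS]mulr_natr ler_wpM2l ?ler0n //.
    by rewrite -natrX ler_nat -card_tuple max_card.
  have h3 : t%:R * n ^+ s <= m%:R * eps / 4 * n ^+ s by rewrite ler_wpM2r // ltW.
  have := le_trans h0 (lerD h1 (le_trans h2 h3)); lra.
have [X [XU hX]] : exists X : {set V}, X \subset U /\
    eps' * n ^+ s <= #|[set y in G | trace y == X]|%:R.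
  apply: contrapT => noX.
  have : \sum_(X in powerset U) #|[set y in G | trace y == X]|%:R <
         \sum_(X in powerset U) (eps' * n ^+ s).
    apply: ltr_sum; first by apply/hasP; exists set0; rewrite ?mem_index_enum ?inE ?sub0set.
    move=> X; rewrite inE => XU; rewrite ltNge; apply/negP => hX.
    by apply: noX; exists X.
  rewrite sumr_const card_powerset cU -[in X in _ < X]mulr_natl natrX mulrA.
  rewrite [2%:R ^+ m * _]mulrC divfK ?gt_eqF ?exprn_gt0 // ltNge => /negP; apply.
  apply: le_trans cG _; rewrite -natr_sum ler_nat -sum1_card.
  rewrite (partition_big trace (fun X => X \in powerset U)) /=; last first.
    by move=> y _; rewrite inE; apply/subsetP => x; rewrite inE => /andP[].
  by apply: leq_sum => X _; rewrite -sum1dep_card.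
have cX : (t <= #|X|)%N.
  have : 0 < #|[set y in G | trace y == X]|%:R :> R.
    by apply: lt_le_trans hX; rewrite mulr_gt0.
  by rewrite ltr0n => /card_gt0P[y]; rewrite !inE => /andP[? /eqP<-].
have [Y YX cY] := subset_of_card cX.
have [|W [cW hW]] := N1P V VN1 (fun y => [forall x in Y, P [tuple of x :: y]]).
  apply: le_trans hX _; rewrite ler_nat; apply: subset_leq_card.
  apply/subsetP => y; rewrite !inE => /andP[_ /eqP tr]; apply/forall_inP => x xY.
  by have := subsetP YX _ xY; rewrite -tr !inE => /andP[].
exists (fun i => if i is j.+1 then W j else Y); split.
  by case=> [|i] //; rewrite ltnS; exact: cW.
move=> u hu; rewrite (tuple_eta u).
have /forall_inP : [forall x in Y, P [tuple of x :: [tuple of behead u]]].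
  apply: hW => i; rewrite tnth_behead; have := hu (inord i.+1).
  by rewrite inordK ?ltnS ?ltn_ord.
by apply; exact: (hu ord0).
Qed.

(** * Complete multipartite subgraphs of graphs with many cliques *)

Definition clique_tuple (V : finType) (e : rel V) (Z : {set V}) s :=
  [pred u : s.-tuple V | [set x in u] \in cliques e Z s].

Lemma cliques_leq_tuples (V : finType) (e : rel V) (Z : {set V}) s :
  (#|cliques e Z s| <= #|[set u | clique_tuple e Z s u]|)%N.
Proof.
apply: leq_trans (leq_imset_card (fun u : s.-tuple V => [set x in u]) _).
apply: subset_leq_card; apply/subsetP => Q Qcl.
have sQ : size (enum Q) == s by move: Qcl; rewrite -cardE inE => /and3P[].
have QE : Q = [set x in Tuple sQ] by apply/setP => x; rewrite inE memtE /= mem_enum.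
by apply/imsetP; exists (Tuple sQ) => //; rewrite inE /= -QE.
Qed.

Lemma clique_tupleP (V : finType) (e : rel V) (Z : {set V}) s (u : s.-tuple V) :
  clique_tuple e Z s u ->
  (forall i, tnth u i \in Z) /\
  (forall i j, i != j -> tnth u i != tnth u j /\ e (tnth u i) (tnth u j)).
Proof.
rewrite /= inE => /and3P[/subsetP uZ /eqP cu /is_cliqueP cl].
have uu : uniq u by apply/card_uniqP; rewrite size_tuple -[RHS]cu cardsE.
have uni i j : i != j -> tnth u i != tnth u j by rewrite (inj_eq (tuple_uniqP _ uu)).
have mem_u i : tnth u i \in [set x in u] by rewrite inE mem_tnth.
by split => [i|i j ij]; [apply: uZ | split; [exact: uni | apply: cl => //; exact: uni]].
Qed.

(** [clique_supersaturation] relative to the whole vertex set: as Z contains many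
    k-cliques, it is a positive proportion of V. *)
Lemma clique_tuples_dense (R : realType) m k (eps : R) :
  (0 < m)%N -> (0 < k <= m.+1)%N -> 0 < eps ->
  exists2 c : R, 0 < c & forall (V : finType) (e : rel V) (Z : {set V}),
    symmetric e ->
    'C(m, k)%:R / m%:R ^+ k * #|Z|%:R ^+ k + eps * #|V|%:R ^+ k < #|cliques e Z k|%:R ->
    c * #|V|%:R ^+ m.+1 <= #|[set u | clique_tuple e Z m.+1 u]|%:R.
Proof.
move=> m0 /andP[k0 km] eps0.
pose eps1 := Num.min eps 1.
have eps1_gt0 : 0 < eps1 by rewrite lt_min eps0 ltr01.
have eps1_le1 : eps1 <= 1 by rewrite ge_min lexx orbT.
have kR : 0 < k%:R :> R by rewrite ltr0n.
pose eta := eps1 / k%:R.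
have eta0 : 0 < eta by rewrite divr_gt0.
have eta1 : eta <= 1.
  by rewrite ler_pdivrMr // mul1r; apply: le_trans eps1_le1 _; rewrite ler1n.
pose c0 := eps1 * (eta / m.+1%:R) ^+ m.+1.
have c0_gt0 : 0 < c0 by rewrite mulr_gt0 // exprn_gt0 // divr_gt0 // ltr0n.
exists (c0 * eps1 ^+ m.+1); first by rewrite mulr_gt0 ?exprn_gt0.
move=> V e Z e_sym hK; have ZV : #|Z|%:R <= #|V|%:R :> R by rewrite ler_nat max_card.
apply: le_trans (_ : #|cliques e Z m.+1|%:R <= _); last first.
  by rewrite ler_nat cliques_leq_tuples.
have Z0 : 0 <= #|Z|%:R :> R by rewrite ler0n.
have := @clique_supersaturation R V e Z e_sym m k eps1 eta m0 km eps1_gt0.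
rewrite eta0 eta1 => /(_ isT); rewrite mulrC divfK ?gt_eqF // => /(_ (lexx _)).
have Zk : 'C(m, k)%:R / m%:R ^+ k * #|Z|%:R ^+ k + eps1 * #|V|%:R ^+ k <
    #|cliques e Z k|%:R.
  apply: le_lt_trans hK; rewrite lerD2l ler_wpM2r ?exprn_ge0 ?ler0n //.
  by rewrite ge_min lexx.
have -> : ('C(m, k)%:R / m%:R ^+ k + eps1) * #|Z|%:R ^+ k < #|cliques e Z k|%:R.
  apply: le_lt_trans Zk; rewrite mulrDl lerD2l ler_wpM2l ?(ltW eps1_gt0) //.
  by rewrite lerXn2r ?nnegrE.
move=> /(_ isT); apply: le_trans; rewrite -/c0 -[leLHS]mulrA ler_wpM2l ?(ltW c0_gt0) //.
rewrite -exprMn lerXn2r ?nnegrE ?mulr_ge0 ?(ltW eps1_gt0) //.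
rewrite leNgt; apply/negP => small.
have : #|cliques e Z k|%:R <= eps1 * #|V|%:R ^+ k.
  apply: le_trans (_ : #|Z|%:R ^+ k <= _).
    by rewrite -natrX ler_nat cliquesE_leq.
  apply: le_trans (_ : (eps1 * #|V|%:R) ^+ k <= _).
    by rewrite lerXn2r ?nnegrE ?mulr_ge0 ?(ltW eps1_gt0) // ltW.
  rewrite exprMn ler_wpM2r ?exprn_ge0 //.
  by rewrite -[leRHS]expr1 ler_wiXn2l // ltW.
move=> /(lt_le_trans Zk); rewrite gtrDr ltNge => /negP; apply.
by rewrite mulr_ge0 ?divr_ge0 ?exprn_ge0 ?ler0n.
Qed.

(** A box that consists of tuples of a relation contains, for any two of its
    factors, a tuple through any given pair of points. *)
Lemma box_pair (V : finType) s (W : nat -> {set V}) (i j : 'I_s) x y :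
  (forall l, (l < s)%N -> 0 < #|W l|)%N -> i != j -> x \in W i -> y \in W j ->
  exists u : s.-tuple V, [/\ forall l, tnth u l \in W l, tnth u i = x & tnth u j = y].
Proof.
move=> W0 ij xi yj.
pose w l := if l == i then x else if l == j then y else odflt x [pick z in W l].
exists [tuple w l | l < s]; split => [l||]; rewrite tnth_mktuple /w ?eqxx //.
  case: (eqVneq l i) => [->//|_]; case: (eqVneq l j) => [->//|_].
  case: pickP => [z|] // W0l; have := W0 l (ltn_ord l).
  by rewrite (eq_card0 W0l).
by rewrite eq_sym (negPf ij).
Qed.

Lemma erdos_stone_cliques (R : realType) m k t (eps : R) :
  (0 < m)%N -> (0 < k <= m.+1)%N -> (0 < t)%N -> 0 < eps ->
  exists N, forall V : finType, (N <= #|V|)%N -> forall (e : rel V) (Z : {set V}),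
    symmetric e ->
    'C(m, k)%:R / m%:R ^+ k * #|Z|%:R ^+ k + eps * #|V|%:R ^+ k < #|cliques e Z k|%:R ->
    exists W : 'I_m.+1 -> {set V}, (forall i, #|W i| = t /\ W i \subset Z) /\
      forall i j x y, i != j -> x \in W i -> y \in W j -> e x y.
Proof.
move=> m0 km t0 eps0.
have [c c0 cP] := clique_tuples_dense m0 km eps0.
have [N NP] := box_lemma m.+1 t c0.
exists N => V VN e Z e_sym /(cP V e Z e_sym) /(NP V VN) [W [cW hW]].
have W0 l : (l < m.+1)%N -> (0 < #|W l|)%N by move=> /cW ->.
exists (fun i => W i); split => [i|i j x y ij xi yj]; last first.
  have [u [/hW /clique_tupleP [_ /(_ i j ij)[_ h]] ux uy]] := box_pair W0 ij xi yj.
  by rewrite -ux -uy.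
split; first exact: cW.
apply/subsetP => x xi.
have [j ij] : exists j : 'I_m.+1, i != j.
  case: (posnP i) => [i0|i0]; [exists ord_max|exists ord0]; rewrite -val_eqE /= ?i0.
    by rewrite neq_ltn m0.
  by rewrite neq_ltn i0 orbT.
have /card_gt0P[y yj] := W0 j (ltn_ord j).
have [u [/hW /clique_tupleP [h _] ux uy]] := box_pair W0 ij xi yj.
by rewrite -ux; exact: h.
Qed.

(** * Orthonormal planes spanned by equidistant classes *)

Section Frames.
Variable R : realType.

Definition dot d (u v : 'rV[R]_d) : R := (u *m v^T) 0 0.
Definition sqdist d (x y : 'rV[R]_d) : R := \sum_i (x 0 i - y 0 i) ^+ 2.

Section Dot.
Variable d : nat.
Implicit Types u v w x y : 'rV[R]_d.

Lemma dotE u v : dot u v = \sum_i u 0 i * v 0 i.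
Proof. by rewrite /dot mxE; apply: eq_bigr => i _; rewrite mxE. Qed.

Lemma dotC u v : dot u v = dot v u.
Proof. by rewrite !dotE; apply: eq_bigr => i _; rewrite mulrC. Qed.

Lemma dotDl u v w : dot (u + v) w = dot u w + dot v w.
Proof. by rewrite /dot mulmxDl mxE. Qed.

Lemma dotZl a u w : dot (a *: u) w = a * dot u w.
Proof. by rewrite /dot -scalemxAl mxE. Qed.

Lemma dotBl u v w : dot (u - v) w = dot u w - dot v w.
Proof. by rewrite -scaleN1r dotDl dotZl mulN1r. Qed.

Lemma dotZr a u w : dot w (a *: u) = a * dot w u.
Proof. by rewrite dotC dotZl dotC. Qed.

Lemma dotBr u v w : dot w (u - v) = dot w u - dot w v.
Proof. by rewrite dotC dotBl !(dotC w). Qed.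

Lemma dot_ge0 u : 0 <= dot u u.
Proof. by rewrite dotE sumr_ge0 // => i _; rewrite -expr2 sqr_ge0. Qed.

Lemma dot_eq0 u : (dot u u == 0) = (u == 0).
Proof.
apply/eqP/eqP => [|->]; last by rewrite /dot mul0mx mxE.
rewrite dotE => /psumr_eq0P h; apply/rowP => i; rewrite mxE.
have /eqP := h (fun i _ => sqr_ge0 (u 0 i)) i isT.
by rewrite mulf_eq0 orbb => /eqP.
Qed.

Lemma sqdistE x y : sqdist x y = dot (x - y) (x - y).
Proof. by rewrite dotE; apply: eq_bigr => i _; rewrite !mxE expr2. Qed.

Lemma sqdist_eq0 x y : sqdist x y = 0 -> x = y.
Proof. by rewrite sqdistE => /eqP; rewrite dot_eq0 subr_eq0 => /eqP. Qed.

Lemma sqdist_sym x y : sqdist x y = sqdist y x.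
Proof. by apply: eq_bigr => i _; rewrite -sqrrN opprB. Qed.

(** The last clause says that f and g span no more than the plane of p and q. *)
Lemma gram_schmidt p q :
  (forall s t, s *: p + t *: q = 0 -> s = 0 /\ t = 0) ->
  exists f g, [/\ dot f f = 1, dot g g = 1, dot f g = 0 &
    forall u, dot u p = 0 -> dot u q = 0 -> dot u f = 0 /\ dot u g = 0].
Proof.
move=> free_pq.
have normalize u : u != 0 -> exists2 l, l != 0 & dot (l *: u) (l *: u) = 1.
  rewrite -dot_eq0 => u0; have u_gt0 : 0 < dot u u by rewrite lt0r u0 dot_ge0.
  exists (Num.sqrt (dot u u))^-1; first by rewrite invr_eq0 gt_eqF // sqrtr_gt0.
  rewrite dotZl dotZr -[X in _ * (_ * X)]sqr_sqrtr ?dot_ge0 //.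
  have : Num.sqrt (dot u u) != 0 by rewrite gt_eqF // sqrtr_gt0.
  by move: (Num.sqrt _) => s s0; field.
have [|l l0 fE] := normalize p.
  apply/eqP => p0; have [] := free_pq 1 0.
    by rewrite scale0r addr0 p0 scaler0.
  by move=> /eqP; rewrite oner_eq0.
pose f := l *: p; pose q' := q - dot q f *: f.
have fq' : dot f q' = 0.
  by rewrite dotBr dotZr fE mulr1 (dotC q) subrr.
have [|m m0 gE] := normalize q'.
  apply/eqP => q'0; have [] := free_pq (- (dot q f * l)) 1.
    by rewrite scale1r scaleNr -scalerA addrC.
  by move=> _ /eqP; rewrite oner_eq0.
exists f, (m *: q'); split => //; first by rewrite dotZr fq' mulr0.
move=> u up uq; have uf : dot u f = 0 by rewrite dotZr up mulr0.
by rewrite dotZr dotBr uq dotZr uf !mulr0 subrr mulr0.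
Qed.

Lemma equidistant_dot v w x y : sqdist v x = sqdist v y -> sqdist w x = sqdist w y ->
  dot (v - w) (x - y) = 0.
Proof.
rewrite !sqdistE !(dotBl, dotBr) (dotC x v) (dotC y v) (dotC x w) (dotC y w).
lra.
Qed.

(** Three collinear points cannot be equidistant from y, since a line meets a sphere at
    most twice. *)
Lemma equidistant_free y x0 x1 x2 : x0 != x1 -> x0 != x2 -> x1 != x2 ->
  sqdist y x0 = sqdist y x1 -> sqdist y x0 = sqdist y x2 ->
  forall s t, s *: (x1 - x0) + t *: (x2 - x0) = 0 -> s = 0 /\ t = 0.
Proof.
move=> x01 x02 x12 e1 e2 s t st0.
set p := x1 - x0 in st0 *; set q := x2 - x0 in st0 *.
have pp : dot p p + 2 * dot (x0 - y) p = 0.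
  move: e1; rewrite /p !sqdistE !(dotBl, dotBr).
  by rewrite ?(dotC x1 x0) ?(dotC x1 y) ?(dotC x0 y); lra.
have qq : dot q q + 2 * dot (x0 - y) q = 0.
  move: e2; rewrite /q !sqdistE !(dotBl, dotBr).
  by rewrite ?(dotC x2 x0) ?(dotC x2 y) ?(dotC x0 y); lra.
have p0 : p != 0 by rewrite subr_eq0 eq_sym.
have [t0|t0] := eqVneq t 0.
  split => //; move: st0; rewrite t0 scale0r addr0 => /eqP.
  by rewrite scaler_eq0 (negPf p0) orbF => /eqP.
have qE : q = (- s / t) *: p.
  apply: (scalerI t0); rewrite scalerA mulrCA mulfV // mulr1 scaleNr.
  by apply/eqP; rewrite -addr_eq0 addrC st0.
move: (- s / t) qE qq => m qE.
have q0 : q != 0 by rewrite subr_eq0 eq_sym.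
have m0 : m != 0 by apply: contraNneq q0 => m0; rewrite qE m0 scale0r.
rewrite qE dotZl !dotZr => qq.
have ppN : dot p p != 0 by rewrite dot_eq0.
have m1 : m = 1.
  apply/eqP; rewrite -subr_eq0; have : m * (dot p p * (m - 1)) = 0.
    have -> : m * (dot p p * (m - 1)) =
       (m * (m * dot p p) + 2 * (m * dot (x0 - y) p)) - m * (dot p p + 2 * dot (x0 - y) p).
      by ring.
    by rewrite qq pp mulr0 subrr.
  by move=> /eqP; rewrite !mulf_eq0 (negPf m0) (negPf ppN).
move: x12; rewrite -subr_eq0 -(subrKA x0) -/p -(opprB x2) -/q qE m1 scale1r.
by rewrite subrr eqxx.
Qed.

End Dot.

(** An orthonormal family of 2r vectors of R^(2r) is a basis: a left inverse of a square
    matrix is a right inverse. *)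
Lemma parseval r (f g : 'I_r -> 'rV[R]_(r + r)) :
  (forall a b, dot (f a) (f b) = (a == b)%:R) ->
  (forall a b, dot (g a) (g b) = (a == b)%:R) ->
  (forall a b, dot (f a) (g b) = 0) ->
  forall u, dot u u = \sum_a (dot u (f a) ^+ 2 + dot u (g a) ^+ 2).
Proof.
move=> ff gg fg u.
pose F := \matrix_a f a; pose G := \matrix_a g a; pose B := col_mx F G.
have entry (h h' : 'I_r -> 'rV[R]_(r + r)) a b :
    (\matrix_a h a *m (\matrix_a h' a)^T) a b = dot (h a) (h' b).
  by rewrite mxE dotE; apply: eq_bigr => i _; rewrite !mxE.
have BB : B *m B^T = 1%:M.
  rewrite /B tr_col_mx mul_col_row scalar_mx_block.
  congr block_mx; apply/matrixP => a b; rewrite entry ?mxE //.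
  by rewrite dotC.
have {}BB := mulmx1C BB.
have -> : dot u u = \sum_i (u *m B^T) 0 i ^+ 2.
  have -> : dot u u = dot (u *m B^T) (u *m B^T).
    by rewrite /dot trmx_mul trmxK mulmxA -(mulmxA u) BB mulmx1.
  by rewrite dotE; apply: eq_bigr => i _; rewrite expr2.
rewrite tr_col_mx mul_mx_row big_split_ord [RHS]big_split /=.
by congr (_ + _); apply: eq_bigr => a _; rewrite ?row_mxEl ?row_mxEr !mxE dotE;
  congr (_ ^+ 2); apply: eq_bigr => i _; rewrite !mxE.
Qed.

(** Each class spans a plane, because its points are equidistant from a point of another
    class, and the planes are orthogonal, because x and x' in one class are equidistant
    from y and y' in another.  The coordinates in the plane of a class are taken from a
    point of another class as origin; it is equidistant from the class, so it projects to the
    centre of its circle, and equidistance from the class means that both coordinates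
    vanish. *)
Lemma frame_exists r (x : 'I_r -> 'I_3 -> 'rV[R]_(r + r)) :
  (1 < r)%N -> (forall a, injective (x a)) ->
  (forall a b i j i' j', a != b ->
     sqdist (x a i) (x b j) = sqdist (x a i') (x b j')) ->
  exists al be : 'I_r -> 'rV[R]_(r + r) -> R,
    (forall v w, sqdist v w =
       \sum_a ((al a v - al a w) ^+ 2 + (be a v - be a w) ^+ 2)) /\
    (forall a v, (forall i j, sqdist v (x a i) = sqdist v (x a j)) ->
       al a v = 0 /\ be a v = 0).
Proof.
move=> r1 x_inj x_const.
pose i0 : 'I_3 := inord 0; pose i1 : 'I_3 := inord 1; pose i2 : 'I_3 := inord 2.
have ineq (i j : 'I_3) : val i != val j -> forall a, x a i != x a j.
  by move=> ij a; rewrite (inj_eq (x_inj a)) -val_eqE.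
have other a : exists b : 'I_r, a != b.
  have r0 : (0 < r)%N by exact: ltnW.
  have [a0|a0] := posnP a; [exists (Ordinal r1)|exists (Ordinal r0)].
    by rewrite -val_eqE /= a0.
  by rewrite -val_eqE /= -lt0n.
have {other} [o oP] := fin_all_exists other.
pose c a := x (o a) i0.
have cP a i j : sqdist (c a) (x a i) = sqdist (c a) (x a j).
  by apply: x_const; rewrite eq_sym.
pose p a := x a i1 - x a i0; pose q a := x a i2 - x a i0.
have /fin_all_exists [f /fin_all_exists [g fgP]] a := @gram_schmidt _ (p a) (q a)
  (@equidistant_free _ (c a) (x a i0) (x a i1) (x a i2)
    (ltac:(by apply: ineq; rewrite /= !inordK))
    (ltac:(by apply: ineq; rewrite /= !inordK))
    (ltac:(by apply: ineq; rewrite /= !inordK)) (cP a _ _) (cP a _ _)).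
have cross a b i j i' j' : a != b -> dot (x a i - x a j) (x b i' - x b j') = 0.
  by move=> ab; apply: equidistant_dot; apply: x_const.
pose in_plane a h := forall u, dot u (p a) = 0 -> dot u (q a) = 0 -> dot u h = 0.
have fP a : in_plane a (f a) by move=> u up uq; have [_ _ _ /(_ u up uq)[]] := fgP a.
have gP a : in_plane a (g a) by move=> u up uq; have [_ _ _ /(_ u up uq)[]] := fgP a.
have planes a b h h' : in_plane a h -> in_plane b h' -> a != b -> dot h h' = 0.
  move=> ha hb ab; have ab0 y : dot (p a) y = 0 -> dot (q a) y = 0 -> dot h y = 0.
    by rewrite !(dotC _ y); exact: ha.
  by apply: hb; apply: ab0; exact: cross.
exists (fun a v => dot (v - c a) (f a)), (fun a v => dot (v - c a) (g a)); split.
  move=> v w; rewrite sqdistE (@parseval _ f g).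
  - by apply: eq_bigr => a _; rewrite -!dotBl opprB addrA subrK.
  - move=> a b; have [->|ab] := eqVneq a b; last exact: planes (fP a) (fP b) ab.
    by have [] := fgP b.
  - move=> a b; have [->|ab] := eqVneq a b; last exact: planes (gP a) (gP b) ab.
    by have [] := fgP b.
  - move=> a b; have [->|ab] := eqVneq a b; last exact: planes (fP a) (gP b) ab.
    by have [] := fgP b.
move=> a v hv; split; [apply: fP|apply: gP]; exact: equidistant_dot.
Qed.

End Frames.

(** * Planes and circles in adapted coordinates *)

Section Planes.
Variables (R : realType) (V : finType) (r : nat) (D : V -> V -> R).

(** Coordinates of an orthogonal sum of r planes: al a and be a are the two coordinates
    in plane a. *)
Definition plane_coords (al be : 'I_r -> V -> R) :=
  forall v w, D v w = \sum_a ((al a v - al a w) ^+ 2 + (be a v - be a w) ^+ 2).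

Definition equidistant_classes (I : finType) (T : I -> {set V}) :=
  forall a b x x' y y', a != b -> x \in T a -> x' \in T a ->
    y \in T b -> y' \in T b -> D x y = D x' y'.

(** What is used of the dimension 2r: r equidistant classes with at least three points
    each determine orthogonal planes that fill the space. *)
Definition planar :=
  forall T : 'I_r -> {set V}, (forall a, 2 < #|T a|)%N -> equidistant_classes T ->
  exists al be, plane_coords al be /\
    forall a v, {in T a &, forall x y, D v x = D v y} -> al a v = 0 /\ be a v = 0.

Hypothesis D_eq0 : forall v w, D v w = 0 -> v = w.

(** Along the line p x + q y = c the position is measured by tau = p y - q x, and its
    square is determined by the circle; so two of three points have the same tau. *)
Lemma line_circle (p q c s x1 y1 x2 y2 x3 y3 : R) :
  p ^+ 2 + q ^+ 2 != 0 ->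
  x1 ^+ 2 + y1 ^+ 2 = s -> x2 ^+ 2 + y2 ^+ 2 = s -> x3 ^+ 2 + y3 ^+ 2 = s ->
  p * x1 + q * y1 = c -> p * x2 + q * y2 = c -> p * x3 + q * y3 = c ->
  [\/ x1 = x2 /\ y1 = y2, x2 = x3 /\ y2 = y3 | x3 = x1 /\ y3 = y1].
Proof.
move=> M0 s1 s2 s3 c1 c2 c3.
pose tau x y : R := p * y - q * x.
have tau2 x y : x ^+ 2 + y ^+ 2 = s -> p * x + q * y = c ->
    tau x y ^+ 2 = (p ^+ 2 + q ^+ 2) * s - c ^+ 2.
  by move=> <- <-; rewrite /tau; ring.
have inj x y x' y' : p * x + q * y = c -> p * x' + q * y' = c ->
    tau x y = tau x' y' -> x = x' /\ y = y'.
  move=> cx cx' tt; split; apply: (mulfI M0).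
    have -> : (p ^+ 2 + q ^+ 2) * x = p * (p * x + q * y) - q * tau x y.
      by rewrite /tau; ring.
    by rewrite cx tt -cx' /tau; ring.
  have -> : (p ^+ 2 + q ^+ 2) * y = q * (p * x + q * y) + p * tau x y.
    by rewrite /tau; ring.
  by rewrite cx tt -cx' /tau; ring.
have e12 : tau x1 y1 ^+ 2 = tau x2 y2 ^+ 2 by rewrite !tau2.
have e13 : tau x1 y1 ^+ 2 = tau x3 y3 ^+ 2 by rewrite !tau2.
move/eqP: e12; rewrite eqf_sqr => /orP[/eqP e|/eqP e12].
  by constructor 1; exact: inj.
move/eqP: e13; rewrite eqf_sqr => /orP[/eqP e|/eqP e13].
  by constructor 3; have [] := inj _ _ _ _ c1 c3 e.
by constructor 2; apply: inj => //; apply: oppr_inj; rewrite -e12.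
Qed.

Section Coords.
Variables al be : 'I_r -> V -> R.
Hypothesis coordsP : plane_coords al be.

Definition weight a v := al a v ^+ 2 + be a v ^+ 2.
Definition norm2 v := \sum_a weight a v.
Definition in_plane a v := [forall b, (b != a) ==> (weight b v == 0)].

Lemma weight_ge0 a v : 0 <= weight a v.
Proof. by rewrite addr_ge0 ?sqr_ge0. Qed.

Lemma weight_eq0 a v : weight a v = 0 -> al a v = 0 /\ be a v = 0.
Proof.
move/eqP; rewrite paddr_eq0 ?sqr_ge0 // !sqrf_eq0.
by move=> /andP[/eqP-> /eqP->].
Qed.

Lemma in_planeP a v : reflect (forall b, b != a -> weight b v = 0) (in_plane a v).
Proof.
apply: (iffP forallP) => [h b ba|h b]; first by have /implyP/(_ ba)/eqP := h b.
by apply/implyP => /h ->.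
Qed.

Lemma norm2_plane a v : in_plane a v -> norm2 v = weight a v.
Proof.
move=> /in_planeP h; rewrite /norm2 (bigD1 a) //= big1 ?addr0 //.
Qed.

Lemma dist_plane a v w : in_plane a w ->
  D v w = norm2 v + norm2 w - 2 * (al a v * al a w + be a v * be a w).
Proof.
move=> wa; rewrite (norm2_plane wa) coordsP /norm2 (bigD1 a) //=.
rewrite [\sum_b weight b v](bigD1 a) //= /weight.
rewrite (eq_bigr (fun b => weight b v)); first by rewrite /weight; ring.
move=> b ba; have [-> ->] := weight_eq0 (in_planeP _ _ wa b ba).
by rewrite !subr0.
Qed.

(** This is how points on orthogonal circles come to have constant distance. *)
Lemma dist_perp a v w : in_plane a w -> weight a v = 0 -> D v w = norm2 v + norm2 w.
Proof.
by move=> wa /weight_eq0[v1 v2]; rewrite (dist_plane v wa) v1 v2 !mul0r addr0 mulr0 subr0.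
Qed.

Lemma in_plane_eq a v w : in_plane a v -> in_plane a w ->
  al a v = al a w -> be a v = be a w -> v = w.
Proof.
move=> /in_planeP va /in_planeP wa ea eb; apply: D_eq0; rewrite coordsP big1 // => b _.
have [->|ba] := eqVneq b a; first by rewrite ea eb !subrr expr0n addr0.
have [-> ->] := weight_eq0 (va _ ba); have [-> ->] := weight_eq0 (wa _ ba).
by rewrite subrr expr0n addr0.
Qed.

(** The sphere around v cuts the plane of the circle in a line condition on w, which is
    not trivial as v has a component in that plane. *)
Lemma circle_meet a v nu c : weight a v != 0 ->
  (#|[set w | [&& in_plane a w, norm2 w == nu & D v w == c]]| <= 2)%N.
Proof.
move=> va; rewrite leqNgt; apply/negP => /card_gt2P.
move=> [w1 [w2 [w3 [[]]]]]; rewrite !inE => /and3P[w1a /eqP n1 /eqP d1].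
move=> /and3P[w2a /eqP n2 /eqP d2] /and3P[w3a /eqP n3 /eqP d3] [w12 w23 w31].
have lin w : in_plane a w -> norm2 w = nu -> D v w = c ->
    al a v * al a w + be a v * be a w = (norm2 v + nu - c) / 2.
  by move=> wa nw dw; have := dist_plane v wa; rewrite dw nw; lra.
have [] := line_circle va (esym (norm2_plane w1a)) (etrans (esym (norm2_plane w2a)) _)
  (etrans (esym (norm2_plane w3a)) _) (lin _ w1a n1 d1) (lin _ w2a n2 d2) (lin _ w3a n3 d3).
- by rewrite n1.
- by rewrite n1.
- by case=> ea eb; move: w12; rewrite (in_plane_eq w1a w2a ea eb) eqxx.
- by case=> ea eb; move: w23; rewrite (in_plane_eq w2a w3a ea eb) eqxx.
- by case=> ea eb; move: w31; rewrite (in_plane_eq w3a w1a ea eb) eqxx.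
Qed.

End Coords.

(** A point of T a is equidistant from the points of any other class, hence lies in
    plane a; its distance to a point of another class then determines its norm. *)
Lemma planar_circles (T : 'I_r -> {set V}) : (1 < r)%N -> planar ->
  (forall a, 2 < #|T a|)%N -> equidistant_classes T ->
  exists al be rho, [/\ plane_coords al be,
    forall a x, x \in T a -> in_plane al be a x &
    forall a x, x \in T a -> norm2 al be x = rho a].
Proof.
move=> r1 pl cT eqT; have [al [be [coordsP T0]]] := pl T cT eqT.
have Tpl a x : x \in T a -> in_plane al be a x.
  move=> xa; apply/in_planeP => b ba; rewrite /weight.
  have [|-> ->] := T0 b x; last by rewrite expr0n addr0.
  by move=> y y' yb y'b; apply: (eqT a b) => //; rewrite eq_sym.
have T_ne a : exists x, x \in T a.
  by apply/card_gt0P; apply: leq_ltn_trans (cT a).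
have {T_ne} [o oP] := fin_all_exists T_ne.
exists al, be, (fun a => norm2 al be (o a)); split => // a x xa.
have [b ab] : exists b : 'I_r, a != b.
  have r0 : (0 < r)%N by exact: ltnW.
  have [a0|a0] := posnP a; [exists (Ordinal r1)|exists (Ordinal r0)].
    by rewrite -val_eqE /= a0.
  by rewrite -val_eqE /= -lt0n.
have E y : y \in T a -> D y (o b) = norm2 al be y + norm2 al be (o b).
  move=> ya; apply: (dist_perp coordsP (Tpl _ _ (oP b))).
  by have /in_planeP h := Tpl _ _ ya; apply: h; rewrite eq_sym.
have := eqT a b x (o a) (o b) (o b) ab xa (oP a) (oP b) (oP b).
by rewrite !E //; apply: addIr.
Qed.

End Planes.

Lemma planar_rV (R : realType) (V : finType) r (p : V -> 'rV[R]_(r + r)) :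
  (1 < r)%N -> injective p -> planar r (fun v w => sqdist (p v) (p w)).
Proof.
move=> r1 p_inj T cT eqT.
have pick3 a : exists x : 'I_3 -> V, injective x /\ forall i, x i \in T a.
  have /card_gt2P[x [y [z [[xa ya za] [xy yz zx]]]]] := cT a.
  exists (fun i => nth x [:: x; y; z] i); split; last first.
    move=> i; have : nth x [:: x; y; z] i \in [:: x; y; z] by rewrite mem_nth.
    by rewrite !inE => /or3P[]/eqP->.
  move=> i j /eqP; rewrite nth_uniq //= ?ltn_ord //; first by move/eqP/val_inj.
  by rewrite !inE negb_or xy yz eq_sym zx.
have {pick3} [x xP] := fin_all_exists pick3.
have [|a b i j i' j' ab|al [be [coordsP al0]]] :=
    @frame_exists R r (fun a i => p (x a i)) r1.
- by move=> a; apply: inj_comp p_inj _; have [] := xP a.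
- by have [_ xa] := xP a; have [_ xb] := xP b; apply: (eqT a b).
exists (fun a v => al a (p v)), (fun a v => be a (p v)); split => [v w|a v hv].
  exact: coordsP.
by apply: al0 => i j; have [_ xa] := xP a; exact: hv.
Qed.

(** * Counting sets by extension and by colours *)

Section Counting.
Variables (R : realType) (V : finType).
Implicit Types (A B Q S : {set V}) (F : {set {set V}}).

Lemma card_bigcup_le (I T : finType) (P : pred I) (G : I -> {set T}) :
  (#|\bigcup_(i | P i) G i| <= \sum_(i | P i) #|G i|)%N.
Proof.
elim/big_rec2: _ => [|i n U _ IH]; first by rewrite cards0.
by apply: leq_trans (leq_card_setU _ _) _; rewrite leq_add2l.
Qed.

Lemma card_bigcup_const A (P : pred V) (G : V -> {set V}) (c : R) :
  0 <= c -> {in A, forall x, P x -> #|G x|%:R <= c} ->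
  #|\bigcup_(x in A | P x) G x|%:R <= #|A|%:R * c.
Proof.
move=> c0 hG; apply: le_trans (_ : (\sum_(x in A | P x) #|G x|)%:R <= _).
  by rewrite ler_nat card_bigcup_le.
rewrite natr_sum; apply: le_trans (_ : \sum_(x in A | P x) c <= _).
  by apply: ler_sum => x /andP[]; exact: hG.
rewrite sumr_const -[leLHS]mulr_natl ler_wpM2r // ler_nat.
by apply: subset_leq_card; apply/subsetP => x /andP[].
Qed.

Lemma card_subsets_leq q : (#|[set S : {set V} | #|S| == q]| <= #|V| ^ q)%N.
Proof.
have := @cliquesE_leq V (fun _ _ => true) (fun _ _ => erefl) setT q.
rewrite cardsT; apply: leq_trans; apply: subset_leq_card; apply/subsetP => S.
by rewrite !inE subsetT => -> /=; apply/is_cliqueP.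
Qed.

(** Each set in F is recovered from a subset with one element y less, given which there
    are at most c candidates for y. *)
Lemma card_by_extension F q (Phi : {set V} -> {set V}) (c : R) :
  0 <= c ->
  {in F, forall S, exists2 y, y \in S & #|S :\ y| = q /\ y \in Phi (S :\ y)} ->
  (forall Q, #|Q| = q -> #|Phi Q|%:R <= c) ->
  #|F|%:R <= c * #|V|%:R ^+ q.
Proof.
move=> c0 hF hPhi.
have FU : F \subset \bigcup_(Q : {set V} | #|Q| == q) [set y |: Q | y in Phi Q].
  apply/subsetP => S /hF[y yS [cS yPhi]].
  apply/bigcupP; exists (S :\ y); first exact/eqP.
  by apply/imsetP; exists y => //; rewrite setD1K.
apply: le_trans (_ : (\sum_(Q : {set V} | #|Q| == q) #|Phi Q|)%:R <= _).
  rewrite ler_nat; apply: leq_trans (subset_leq_card FU) _.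
  apply: leq_trans (card_bigcup_le _ _) _; apply: leq_sum => Q _.
  exact: leq_imset_card.
rewrite natr_sum; apply: le_trans (_ : \sum_(Q : {set V} | #|Q| == q) c <= _).
  by apply: ler_sum => Q /eqP; exact: hPhi.
rewrite sumr_const -[leLHS]mulr_natr ler_wpM2l // -natrX ler_nat.
by apply: leq_trans (card_subsets_leq q); apply: subset_leq_card; apply/subsetP=> S; rewrite inE.
Qed.

Lemma card_meeting F q A :
  {in F, forall S, exists2 y, y \in S & #|S :\ y| = q /\ y \in A} ->
  #|F|%:R <= #|A|%:R * #|V|%:R ^+ q :> R.
Proof. by move=> hF; apply: (@card_by_extension F q (fun=> A)). Qed.

(** Rainbow sets are the cliques of a multipartite graph with at most m classes, which
    has no clique of rank m + 1. *)
Lemma zykov_colors (I : finType) (col : V -> I) A m q :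
  (0 < m)%N -> (q <= m.+1)%N -> (#|col @: A| <= m)%N ->
  #|cliques (fun x y => col x != col y) A q|%:R <=
    'C(m, q)%:R * (#|A|%:R / m%:R) ^+ q :> R.
Proof.
move=> m0 qm cA; apply: zykov => //; first by move=> x y; rewrite eq_sym.
apply/eqP; rewrite cards_eq0; apply/eqP/setP => Q; rewrite !inE.
apply/negP => /and3P[QA /eqP cQ /is_cliqueP clQ].
have : (#|col @: Q| <= m)%N.
  by apply: leq_trans cA; apply: subset_leq_card; exact: imsetS.
rewrite card_in_imset ?cQ ?ltnn // => x y xQ yQ exy.
by apply/eqP; apply: contraT => xy; have := clQ x y xQ yQ xy; rewrite exy eqxx.
Qed.

End Counting.

(** * Equidistant classes in sets with many simplices *)

Section Simplices.
Variables (R : realType) (V : finType) (D : V -> V -> R).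

Definition monochromatic (S : {set V}) :=
  exists c, {in S &, forall x y, x != y -> D x y = c}.

Definition simplices (k : nat) : {set {set V}} :=
  [set S : {set V} | (#|S| == k) && `[< monochromatic S >]].

Lemma simplicesP k (S : {set V}) :
  reflect (#|S| = k /\ monochromatic S) (S \in simplices k).
Proof.
rewrite inE; apply: (iffP andP) => [[/eqP-> /asboolP]//|[-> h]].
by split => //; apply/asboolP.
Qed.

(** The third vertices of the equilateral triangles with side x y. *)
Definition apexes x y := [set z | (D x z == D x y) && (D y z == D x y)].

End Simplices.

(** Averaging over all z: J -> V, where the tuple u admits at least (eps n)^|J| choices. *)
Lemma choose_coordinates (R : realType) (V J : finType) s (P : pred (s.-tuple V))
    (E : J -> s.-tuple V -> V -> bool) (c eps : R) :
  0 <= c -> 0 <= eps -> (0 < #|V|)%N ->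
  c * #|V|%:R ^+ s <= #|[set u | P u]|%:R ->
  (forall u, P u -> forall j, eps * #|V|%:R <= #|[set z | E j u z]|%:R) ->
  exists z : J -> V,
    c * eps ^+ #|J| * #|V|%:R ^+ s <= #|[set u | [forall j, E j u (z j)]]|%:R.
Proof.
move=> c0 eps0 V0 hP hE; have n0 : 0 < #|V|%:R :> R by rewrite ltr0n.
have fam u : P u ->
    (eps * #|V|%:R) ^+ #|J| <= #|[set z : {ffun J -> V} | [forall j, E j u (z j)]]|%:R.
  move=> Pu; have -> : #|[set z : {ffun J -> V} | [forall j, E j u (z j)]]| =
      #|family (fun j => [pred z | E j u z])|.
    by rewrite cardsE; apply: eq_card => z; rewrite !inE.
  rewrite card_family foldrE big_map big_enum natr_prod -prodr_const.
  apply: ler_prod => j _; rewrite mulr_ge0 ?(ltW n0) //=.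
  by have := hE u Pu j; rewrite cardsE.
apply: contrapT => noz.
have : \sum_(z : {ffun J -> V}) #|[set u | [forall j, E j u (z j)]]|%:R <
       \sum_(z : {ffun J -> V}) c * eps ^+ #|J| * #|V|%:R ^+ s.
  apply: ltr_sum.
    have /card_gt0P[v _] := V0.
    by apply/hasP; exists [ffun=> v]; rewrite ?mem_index_enum.
  by move=> z _; rewrite ltNge; apply/negP => hz; apply: noz; exists z.
rewrite sumr_const -[X in _ < X]mulr_natl card_ffun natrX ltNge => /negP; apply.
have swap : (\sum_(z : {ffun J -> V}) #|[set u | [forall j, E j u (z j)]]| =
   \sum_u #|[set z : {ffun J -> V} | [forall j, E j u (z j)]]|)%N.
  under eq_bigr do rewrite -sum1dep_card big_mkcond.
  rewrite exchange_big; apply: eq_bigr => u _ /=.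
  by rewrite -big_mkcond /= sum1dep_card.
rewrite -natr_sum swap natr_sum (bigID (mem [set u | P u])) /=.
apply: le_trans (_ : \sum_(u in [set u | P u]) (eps * #|V|%:R) ^+ #|J| <= _).
  rewrite sumr_const -[leRHS]mulr_natl exprMn.
  rewrite [leLHS](_ : _ = c * #|V|%:R ^+ s * (eps ^+ #|J| * #|V|%:R ^+ #|J|)); last by ring.
  by rewrite ler_wpM2r // mulr_ge0 // exprn_ge0 // ltW.
rewrite -[leLHS]addr0 lerD ?sumr_ge0 //.
by apply: ler_sum => u; rewrite inE; exact: fam.
Qed.

Lemma card_setD1_in (V : finType) (S : {set V}) z : z \in S -> #|S :\ z| = #|S|.-1.
Proof. by move=> zS; rewrite (cardsD1 z S) zS. Qed.

Lemma exists_third (V : finType) (S : {set V}) x y : (2 < #|S|)%N ->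
  exists z, [/\ z \in S, z != x & z != y].
Proof.
move=> cS; have /card_gt0P[z] : (0 < #|S :\ x :\ y|)%N.
  have := cardsD1 x S; have := cardsD1 y (S :\ x).
  by case: (x \in S); case: (y \in _); lia.
by rewrite !inE => /and3P[zy zx zS]; exists z.
Qed.

(** Each pair of an r-clique of heavy pairs has many apexes.  Fixing one apex z for each
    pair of positions, such that many r-cliques fit it, and then taking a box, the
    distance of x in T a to y in T b is at the same time the distance of x to z and of y
    to z, so it depends neither on y nor on x. *)
Lemma classes_exist (R : realType) m k t (eps : R) :
  (0 < m)%N -> (3 <= k <= m.+1)%N -> (0 < t)%N -> 0 < eps ->
  exists N, forall V : finType, (N <= #|V|)%N -> forall D : V -> V -> R,
    (forall x y, D x y = D y x) ->
    ('C(m, k)%:R / m%:R ^+ k + eps) * #|V|%:R ^+ k < #|simplices D k|%:R ->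
    exists T : 'I_m.+1 -> {set V},
      (forall a, #|T a| = t) /\ equidistant_classes D T.
Proof.
move=> m0 /andP[k3 km] t0 eps0.
have k0 : (0 < k)%N by apply: leq_trans k3.
have kR : 0 < k%:R :> R by rewrite ltr0n.
pose eps1 := Num.min 1 (eps / 2 / k%:R ^+ 2).
have e1_gt0 : 0 < eps1 by rewrite lt_min ltr01 !divr_gt0 // exprn_gt0.
have e1_le1 : eps1 <= 1 by rewrite ge_min lexx.
have e1_le : k%:R ^+ 2 * eps1 <= eps / 2.
  by rewrite mulrC -ler_pdivlMr ?exprn_gt0 // ge_min lexx orbT.
have km' : (0 < k <= m.+1)%N by rewrite k0.
have eps2 : 0 < eps / 2 by rewrite divr_gt0.
have [c c0 cP] := clique_tuples_dense m0 km' eps2.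
pose J := ('I_m.+1 * 'I_m.+1)%type.
have c1_gt0 : 0 < c * eps1 ^+ #|{: J}| by rewrite mulr_gt0 // exprn_gt0.
have [N NP] := box_lemma m.+1 t c1_gt0.
exists (maxn 1 N) => V; rewrite geq_max => /andP[V1 VN] D D_sym hS.
pose n : R := #|V|%:R.
have n0 : 0 < n by rewrite ltr0n.
pose heavy x y := eps1 * n <= #|apexes D x y|%:R.
have heavy_sym : symmetric heavy.
  move=> x y; rewrite /heavy; congr (_ <= #|pred_of_set _|%:R).
  by apply/setP => z; rewrite !inE (D_sym y x) andbC.
pose light := [set S in simplices D k | ~~ is_clique heavy S].
(* A simplex with a light pair is recovered by removing an apex of that pair. *)
have cl : #|light|%:R <= eps / 2 * n ^+ k.
  pose Phi (Q : {set V}) := \bigcup_(x in Q | true) \bigcup_(y in Q | ~~ heavy x y) apexes D x y.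
  have := @card_by_extension R V light k.-1 Phi (k%:R * (k%:R * (eps1 * n))).
  rewrite -/n => h; apply: le_trans (h _ _ _) _.
  - by rewrite !mulr_ge0 // ltW.
  - move=> S; rewrite inE => /andP[/simplicesP[cS [d hd]] ncl].
    have [x [y [xS yS xy nh]]] : exists x y, [/\ x \in S, y \in S, x != y & ~~ heavy x y].
      move: ncl => /forall_inPn[x xS] /forall_inPn[y yS]; rewrite negb_imply => /andP[xy nh].
      by exists x, y.
    have [z [zS zx zy]] : exists z, [/\ z \in S, z != x & z != y].
      by apply: exists_third; rewrite cS.
    exists z => //; split; first by rewrite card_setD1_in // cS.
    apply/bigcupP; exists x; first by rewrite !inE xS eq_sym zx.
    apply/bigcupP; exists y; first by rewrite !inE yS eq_sym zy.
    by rewrite inE !(hd _ _ _ _ _) // ?eqxx // eq_sym.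
  - move=> Q cQ.
    have hQ : #|Q|%:R <= k%:R :> R by rewrite ler_nat cQ leq_pred.
    apply: le_trans (card_bigcup_const (c := k%:R * (eps1 * n)) _ _) _.
    + by rewrite !mulr_ge0 // ltW.
    + move=> x _ _; apply: le_trans (card_bigcup_const (c := eps1 * n) _ _) _.
      * by rewrite !mulr_ge0 // ltW.
      * by move=> y _; rewrite -ltNge => /ltW.
      by rewrite ler_wpM2r // mulr_ge0 // ltW.
    by rewrite ler_wpM2r // !mulr_ge0 // ltW.
  have -> : k%:R * (k%:R * (eps1 * n)) * n ^+ k.-1 = k%:R ^+ 2 * eps1 * n ^+ k.
    have -> : n ^+ k = n * n ^+ k.-1 by rewrite -exprS prednK.
    by ring.
  by rewrite ler_wpM2r // exprn_ge0 // ltW.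
have dense : 'C(m, k)%:R / m%:R ^+ k * #|[set: V]|%:R ^+ k + eps / 2 * n ^+ k <
    #|cliques heavy setT k|%:R.
  rewrite cardsT -/n; have : #|simplices D k|%:R <= #|cliques heavy setT k|%:R + #|light|%:R :> R.
    rewrite -natrD ler_nat; apply: leq_trans (leq_card_setU _ _).
    apply: subset_leq_card; apply/subsetP => S hSk; rewrite !inE.
    move: (hSk); rewrite inE => -> /=; have /simplicesP[-> _] := hSk.
    by rewrite subsetT eqxx /=; case: is_clique.
  by move: hS; rewrite -/n; lra.
have tuples := cP V heavy setT heavy_sym dense.
have [u cu [a b]|z hz] := @choose_coordinates R V J m.+1 (clique_tuple heavy setT m.+1)
   (fun j u z => (j.1 != j.2) ==> (z \in apexes D (tnth u j.1) (tnth u j.2))) c eps1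
   (ltW c0) (ltW e1_gt0) V1 tuples.
  rewrite /=; have [_|ab] := eqVneq a b.
    rewrite (_ : [set z | _] = setT); last by apply/setP => z; rewrite !inE.
    by rewrite cardsT -[leRHS]mul1r ler_wpM2r.
  have [_ /(_ a b ab)[_ hv]] := clique_tupleP cu.
  by rewrite (_ : [set z | _] = apexes D (tnth u a) (tnth u b)) //; apply/setP => z; rewrite !inE.
have [W [cW hW]] := NP V VN _ hz.
have W0 l : (l < m.+1)%N -> (0 < #|W l|)%N by move=> /cW ->.
have apex (a b : 'I_m.+1) x y : a != b -> x \in W a -> y \in W b ->
    D x (z (a, b)) = D x y /\ D y (z (a, b)) = D x y.
  move=> ab xa yb; have [u [/hW /forallP/(_ (a, b)) + ux uy]] := box_pair W0 ab xa yb.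
  by rewrite /= ab ux uy inE => /andP[/eqP -> /eqP ->].
exists (fun a => W a); split => [a|a b x x' y y' ab xa x'a yb y'b]; first exact: cW.
have [_ e1] := apex _ _ _ _ ab xa yb.
have [e2 e3] := apex _ _ _ _ ab x'a yb.
have [e4 _] := apex _ _ _ _ ab x'a y'b.
by rewrite -e4 e2 -e3 -e1.
Qed.

(** * Degrees and orthogonal points *)

Section Link.
Variables (R : realType) (V : finType) (D : V -> V -> R).

Definition degree k v := #|[set S in simplices D k | v \in S]|.

(** The facets opposite to v in the simplices that contain v. *)
Definition link q v : {set {set V}} :=
  [set Q : {set V} | [&& #|Q| == q, v \notin Q & v |: Q \in simplices D q.+1]].

Lemma degree_link q v : degree q.+1 v = #|link q v|.
Proof.
rewrite /degree -(card_in_imset (f := fun S : {set V} => S :\ v)); last first.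
  move=> S S'; rewrite !inE => /andP[_ vS] /andP[_ vS'] /(congr1 (fun Q => v |: Q)).
  by rewrite !setD1K.
apply: eq_card => Q; rewrite [RHS]inE; apply/imsetP/and3P => [[S]|[/eqP cQ vQ hQ]].
  rewrite inE => /andP[hS vS] ->; rewrite setD1K // setD11; split => //.
  by have := cardsD1 v S; have /simplicesP[-> _] := hS; rewrite vS add1n => -[->].
by exists (v |: Q); rewrite ?setU1K // inE hQ setU11.
Qed.

(** As q > 1, the side is determined by Q alone, independently of v. *)
Lemma linkP q v Q : (1 < q)%N -> Q \in link q v ->
  [/\ #|Q| = q, v \notin Q & exists c, {in Q, forall x, D v x = c} /\
    {in Q &, forall x y, x != y -> D x y = c}].
Proof.
move=> q1; rewrite inE => /and3P[/eqP cQ vQ /simplicesP[_ [c hc]]].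
split => //; exists c; split => [x xQ|x y xQ yQ xy].
  by apply: hc; rewrite ?setU11 ?setU1r //; apply: contraNneq vQ => ->.
by apply: hc; rewrite ?setU1r.
Qed.

Lemma exists_other (Q : {set V}) x : (1 < #|Q|)%N -> exists2 y, y \in Q & y != x.
Proof.
move=> cQ; have /card_gt0P[y] : (0 < #|Q :\ x|)%N.
  by have := cardsD1 x Q; case: (x \in Q); lia.
by rewrite !inE => /andP[yx yQ]; exists y.
Qed.

End Link.

Section Coordinates.
Variables (R : realType) (V : finType) (D : V -> V -> R) (r : nat).
Variables (al be : 'I_r -> V -> R).
Hypothesis D_sym : forall x y, D x y = D y x.
Hypothesis D_eq0 : forall x y, D x y = 0 -> x = y.
Hypothesis coordsP : plane_coords D al be.
Let n : R := #|V|%:R.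

Notation weight := (weight al be).
Notation norm2 := (norm2 al be).
Notation in_plane := (in_plane al be).

(** Two points orthogonal to the plane of a circle of squared radius rho that form a
    regular simplex with a point of the circle have this relation. *)
Definition equinormal (rho : R) : rel V :=
  fun x y => (norm2 x == norm2 y) && (D x y == norm2 x + rho).

Definition perp a := [set v | weight a v == 0].

Lemma equinormal_sym rho : symmetric (equinormal rho).
Proof.
move=> x y; rewrite /equinormal eq_sym D_sym.
by case: eqP => //= ->.
Qed.

(** A facet Q that belongs to three points of U has side D v u for every v in Q and all
    three u; by [circle_meet] all its points are orthogonal to the plane of U. *)
Lemma degree_sum q a rho (U : {set V}) : (1 < q)%N ->
  {in U, forall u, in_plane a u /\ norm2 u = rho} ->
  \sum_(u in U) (degree D q.+1 u)%:R <=
    2 * n ^+ q + #|U|%:R * #|cliques (equinormal rho) (perp a) q|%:R.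
Proof.
move=> q1 hU; rewrite -natr_sum.
under eq_bigr do rewrite degree_link -sum1_card big_mkcond.
rewrite exchange_big /=.
pose K := cliques (equinormal rho) (perp a) q.
apply: le_trans (_ : (\sum_(Q : {set V} | #|Q| == q) (2 + #|U| * (Q \in K)))%:R <= _).
  rewrite ler_nat [in leqRHS]big_mkcond; apply: leq_sum => Q _ /=.
  case: ifP => [/eqP cQ|cQ]; last first.
    by rewrite big1 // => u _; rewrite inE cQ.
  rewrite -big_mkcondr /= sum1dep_card; set X := [set u | _].
  have XU : (#|X| <= #|U|)%N.
    by apply: subset_leq_card; apply/subsetP => u; rewrite inE => /andP[].
  have [|X3] := leqP #|X| 2; first by move=> h; rewrite (leq_trans h) // leq_addr.
  suff -> : Q \in K by rewrite muln1 (leq_trans XU) // leq_addl.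
  have [u0 hu0] : exists u, u \in X by apply/card_gt0P; apply: leq_trans X3.
  have uX u : u \in X -> [/\ u \in U, in_plane a u, norm2 u = rho & Q \in link D q u].
    by rewrite inE => /andP[uU uQ]; have [] := hU u uU.
  have [_ _ _ /(linkP q1) [_ _ [c [_ hc]]]] := uX u0 hu0.
  have Dc u v : u \in X -> v \in Q -> D v u = c.
    move=> /uX[_ _ _ /(linkP q1) [_ _ [c' [h1 h2]]]] vQ; rewrite D_sym h1 //.
    have [y yQ yv] : exists2 y, y \in Q & y != v by apply: exists_other; rewrite cQ.
    by rewrite -(h2 y v) // hc.
  have w0 v : v \in Q -> weight a v = 0.
    move=> vQ; apply/eqP; apply: contraTT X3 => wv; rewrite -leqNgt.
    apply: leq_trans (circle_meet D_eq0 coordsP rho c wv); apply: subset_leq_card.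
    apply/subsetP => u uX'; have [_ h1 h2 _] := uX u uX'.
    by rewrite inE h1 h2 Dc ?eqxx.
  have nv v : v \in Q -> norm2 v + rho = c.
    move=> vQ; have [_ h1 h2 _] := uX u0 hu0.
    by rewrite -(Dc u0 v) // (dist_perp coordsP h1) ?w0 // h2.
  rewrite inE cQ eqxx /=; apply/andP; split.
    by apply/subsetP => v vQ; rewrite inE w0.
  apply/is_cliqueP => x y xQ yQ xy; rewrite /equinormal nv // hc // eqxx andbT.
  by apply/eqP; apply: (addIr rho); rewrite !nv.
rewrite big_split /= sum_nat_const -big_distrr /= natrD !natrM lerD //.
  rewrite mulrC ler_wpM2l // -natrX ler_nat.
  have := card_subsets_leq V q; apply: leq_trans; apply: subset_leq_card.
  by apply/subsetP => S; rewrite inE.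
rewrite ler_wpM2l // ler_nat -[leqRHS]sum1_card [leqRHS]big_mkcond [leqLHS]big_mkcond /=.
by apply: leq_sum => Q _; case: ifP => // _; case: (_ \in _).
Qed.

Definition planar_points := [set v | [exists a, in_plane a v && (weight a v != 0)]].

Lemma planar_pointsP v :
  reflect (exists a, in_plane a v /\ weight a v != 0) (v \in planar_points).
Proof.
rewrite inE; apply: (iffP existsP) => [[a /andP[]]|[a [h1 h2]]]; exists a => //.
by rewrite h1.
Qed.

Lemma norm2_eq0 v : norm2 v = 0 -> forall a, weight a v = 0.
Proof.
by move=> /psumr_eq0P h a; apply: h => // b _; exact: weight_ge0.
Qed.

Lemma centre_unique : (#|[set v | norm2 v == 0%R]| <= 1)%N.
Proof.
apply/card_le1_eqP => v w; rewrite !inE => /eqP v0 /eqP w0; apply: D_eq0.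
rewrite coordsP big1 // => a _.
have [-> ->] := weight_eq0 (norm2_eq0 v0 a); have [-> ->] := weight_eq0 (norm2_eq0 w0 a).
by rewrite subrr expr0n addr0.
Qed.

(** Double counting of the pairs (a, v) with v orthogonal to plane a: a point
    has at most r - 2 = m - 1 such planes unless it lies in one of the planes, where it
    has m, or is the centre, where it has r = (m - 1) + 2. *)
Lemma planar_points_large m (x : R) : r = m.+1 -> (0 < m)%N ->
  (forall a, x <= #|perp a|%:R) ->
  r%:R * x - (m.-1%:R * n + 2) <= #|planar_points|%:R.
Proof.
move=> rE m0 hx.
have h1 : r%:R * x <= \sum_a #|perp a|%:R.
  apply: le_trans (_ : \sum_(a < r) x <= _); last by apply: ler_sum.
  by rewrite sumr_const card_ord -[leRHS]mulr_natl.
have h2 : (\sum_a #|perp a| <= m.-1 * #|V| + #|planar_points| + 2)%N.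
  under eq_bigr do rewrite -sum1_card big_mkcond.
  rewrite exchange_big /=.
  have cen := centre_unique.
  apply: leq_trans (_ : \sum_v (m.-1 + (v \in planar_points) + 2 * (norm2 v == 0%R)) <= _)%N.
    apply: leq_sum => v _; rewrite -big_mkcond sum1dep_card.
    have [/eqP v0|v0] := boolP (norm2 v == 0).
      apply: leq_trans (max_card _) _; rewrite card_ord rE; lia.
    rewrite muln0 addn0.
    have [a wa] : exists a, weight a v != 0.
      apply: contrapT => na; case/eqP: v0; rewrite /norm2 big1 // => a _.
      by apply/eqP; apply: contrapT => wa; apply: na; exists a; exact/negP.
    have sub : (#|[set b | v \in perp b]| < r)%N.
      rewrite -[ltnRHS]card_ord -cardsT; apply: proper_card.
      by rewrite properE subsetT; apply/subsetPn; exists a; rewrite !inE.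
    have [vY|vY] := boolP (v \in planar_points); first by rewrite addn1 prednK // -ltnS -rE.
    have [b [ba wb]] : exists b, b != a /\ weight b v != 0.
      apply: contrapT => nb; move/planar_pointsP: vY; apply; exists a; split => //.
      apply/in_planeP => b ba; apply/eqP; apply: contrapT => wb; apply: nb; exists b.
      by split => //; exact/negP.
    have := cardsC [set b | v \in perp b]; rewrite card_ord.
    have : (#|[set a; b]| <= #|~: [set b | v \in perp b]|)%N.
      by apply: subset_leq_card; apply/subsetP => i; rewrite !inE => /orP[]/eqP->.
    by rewrite cards2 eq_sym ba; move: rE m0; clear; lia.
  have e1 : (\sum_v (v \in planar_points) = #|planar_points|)%N.
    by rewrite -sum1_card [RHS]big_mkcond; apply: eq_bigr => v _; case: ifP.
  have e2 : (\sum_v 2 * (norm2 v == 0%R) = 2 * #|[set v | norm2 v == 0%R]|)%N.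
    rewrite -sum1_card big_distrr [RHS]big_mkcond; apply: eq_bigr => v _.
    by rewrite inE; case: ifP.
  have e0 : (\sum_(v : V) m.-1 = m.-1 * #|V|)%N by rewrite sum_nat_const mulnC.
  rewrite big_split big_split /= e0 e1 e2.
  by rewrite leq_add2l -[leqRHS]muln1 leq_mul2l.
move: h2; rewrite -(ler_nat R) !natrD natrM natr_sum -/n; lra.
Qed.

End Coordinates.

(** * Simplices around circles *)

(** The sets in F are split into those that leave A, those with two points of the same
    colour, where Phi lists the candidates for the second one, and rainbow sets. *)
Lemma color_split (R : realType) (V I : finType) (col : V -> I) (F : {set {set V}})
    (A : {set V}) q (Phi : {set V} -> {set V}) (c : R) :
  (0 < q)%N -> 0 <= c -> {in F, forall Q : {set V}, #|Q| = q} ->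
  (forall (Q : {set V}) x y, Q \in F -> Q \subset A -> x \in Q -> y \in Q -> x != y ->
     col x = col y -> y \in Phi (Q :\ y)) ->
  (forall Q : {set V}, #|Q| = q.-1 -> #|Phi Q|%:R <= c) ->
  #|F|%:R <= (#|~: A|%:R + c) * #|V|%:R ^+ q.-1 +
    #|[set Q in F | (Q \subset A) && is_clique (fun x y => col x != col y) Q]|%:R.
Proof.
move=> q0 c0 cF hPhi cPhi.
pose F1 := [set Q in F | ~~ (Q \subset A)].
pose F2 := [set Q in F | (Q \subset A) && ~~ is_clique (fun x y => col x != col y) Q].
set F3 := [set Q in F | _ && _].
have FE : (#|F| <= #|F1| + #|F2| + #|F3|)%N.
  apply: leq_trans (leq_trans (leq_card_setU _ _) (leq_add (leq_card_setU _ _) (leqnn _))).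
  apply: subset_leq_card; apply/subsetP => Q QF; rewrite !inE QF /=.
  by case: (Q \subset A); case: is_clique.
have h1 : #|F1|%:R <= #|~: A|%:R * #|V|%:R ^+ q.-1 :> R.
  apply: card_meeting => Q; rewrite inE => /andP[QF /subsetPn[y yQ yA]].
  by exists y => //; rewrite inE yA card_setD1_in // cF.
have h2 : #|F2|%:R <= c * #|V|%:R ^+ q.-1.
  apply: (@card_by_extension R V F2 q.-1 Phi) => // Q.
  rewrite inE => /and3P[QF QA /forall_inPn[x xQ /forall_inPn[y yQ]]].
  rewrite negb_imply negbK => /andP[xy /eqP cxy].
  by exists y => //; rewrite card_setD1_in // cF //; split => //; exact: hPhi cxy.
rewrite mulrDl; apply: le_trans (lerD (lerD h1 h2) (lexx _)).
by rewrite -!natrD ler_nat.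
Qed.

(** In the coordinates given by T, all points of U have all their coordinates equal
    to 0. *)
Lemma no_extra_class (R : realType) (V : finType) (D : V -> V -> R) r
    (T : 'I_r -> {set V}) (U : {set V}) :
  (forall x y, D x y = 0 -> x = y) -> planar r D ->
  (forall a, 2 < #|T a|)%N -> equidistant_classes D T ->
  (forall a, {in U & T a &, forall u x y, D u x = D u y}) -> (#|U| <= 1)%N.
Proof.
move=> D_eq0 pl cT eqT hU; have [al [be [coordsP T0]]] := pl T cT eqT.
apply/card_le1_eqP => v w vU wU; apply: D_eq0; rewrite coordsP big1 // => a _.
have [-> ->] : al a v = 0 /\ be a v = 0 by apply: T0 => x y; exact: hU.
have [-> ->] : al a w = 0 /\ be a w = 0 by apply: T0 => x y; exact: hU.
by rewrite subrr expr0n addr0.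
Qed.

(** More cliques would produce m + 1 equidistant classes of points orthogonal to plane a.
    As U is equidistant from each of them, U would be an extra class. *)
Lemma perp_cliques_upper (R : realType) m q (eps : R) :
  (0 < m)%N -> (0 < q <= m.+1)%N -> 0 < eps ->
  exists N, forall V : finType, (N <= #|V|)%N -> forall D : V -> V -> R,
    (forall x y, D x y = D y x) -> (forall x y, D x y = 0 -> x = y) ->
    planar m.+1 D -> forall al be, plane_coords D al be ->
    forall (a : 'I_m.+1) rho (U : {set V}), (1 < #|U|)%N ->
    {in U, forall u, in_plane al be a u /\ norm2 al be u = rho} ->
    #|cliques (equinormal D al be rho) (perp al be a) q|%:R <=
      'C(m, q)%:R / m%:R ^+ q * #|perp al be a|%:R ^+ q + eps * #|V|%:R ^+ q.
Proof.
move=> m0 qm eps0; have [N NP] := @erdos_stone_cliques R m q 3 eps m0 qm isT eps0.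
exists N => V VN D D_sym D_eq0 pl al be coordsP a rho U cU hU.
rewrite leNgt; apply/negP => /(NP V VN) [|W [cW hW]]; first exact: equinormal_sym.
have other i : exists j : 'I_m.+1, i != j.
  have [i0|i0] := posnP i; [exists ord_max|exists ord0]; rewrite -val_eqE /= ?i0.
    by rewrite neq_ltn m0.
  by rewrite neq_ltn i0 orbT.
have normW i j x y : i != j -> x \in W i -> y \in W j ->
    norm2 al be x = norm2 al be y /\ D x y = norm2 al be x + rho.
  by move=> ij xi yj; have /andP[/eqP-> /eqP->] := hW i j x y ij xi yj.
have cW2 i : (2 < #|W i|)%N by have [->] := cW i.
have same i x y : x \in W i -> y \in W i -> norm2 al be x = norm2 al be y.
  move=> xi yi; have [j ij] := other i; have /card_gt0P[z zj] : (0 < #|W j|)%N.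
    exact: leq_trans (cW2 j).
  by rewrite (normW i j x z ij xi zj).1 (normW i j y z ij yi zj).1.
suff : (#|U| <= 1)%N by rewrite leqNgt cU.
apply: (@no_extra_class R V D m.+1 W U) => // [i j x x' y y' ij xi x'i yj y'j|i u x y uU xi yi].
  by rewrite (normW i j x y ij xi yj).2 (normW i j x' y' ij x'i y'j).2 (same i x x').
have [ua un] := hU u uU.
have perp_dist z : z \in W i -> D z u = norm2 al be z + rho.
  move=> zi; have [_ /subsetP/(_ z zi)] := cW i; rewrite inE => /eqP za.
  by rewrite (dist_perp coordsP ua za) un.
by rewrite !(D_sym u) !perp_dist // (same i x y).
Qed.

Section Circles.
Variables (R : realType) (V : finType) (D : V -> V -> R) (m : nat).
Local Notation r := m.+1.
Variables (al be : 'I_r -> V -> R).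
Hypothesis D_eq0 : forall x y, D x y = 0 -> x = y.
Hypothesis coordsP : plane_coords D al be.
Hypothesis m1 : (1 < m)%N.
Variable q : nat.
Hypothesis q1 : (1 < q)%N.
Hypothesis qm : (q <= m)%N.
Let n : R := #|V|%:R.

Notation weight := (weight al be).
Notation norm2 := (norm2 al be).
Notation in_plane := (in_plane al be).
Notation planar_points := (planar_points al be).

Definition plane_of v : 'I_r := odflt ord0 [pick a | weight a v != 0].

Lemma plane_ofE a v : in_plane a v -> weight a v != 0 -> plane_of v = a.
Proof.
move=> /in_planeP va wa; rewrite /plane_of; case: pickP => [b wb|/(_ a)]; last by rewrite wa.
by apply/eqP; apply: contraT => /va wb0; rewrite wb0 eqxx in wb.
Qed.

Lemma plane_ofP v : v \in planar_points ->
  in_plane (plane_of v) v /\ weight (plane_of v) v != 0.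
Proof. by move/planar_pointsP => [a [va wa]]; rewrite (plane_ofE va wa). Qed.

Lemma cross_dist x y : x \in planar_points -> y \in planar_points ->
  plane_of x != plane_of y -> D x y = norm2 x + norm2 y.
Proof.
move=> /plane_ofP[xa _] /plane_ofP[ya _] xy; apply: (dist_perp coordsP ya).
by have /in_planeP h := xa; apply: h; rewrite eq_sym.
Qed.

Definition circle a nu v c := [set w | [&& in_plane a w, norm2 w == nu & D v w == c]].

(** The form in which [circle_meet] is used in the counts: given the other points,
    there are at most two candidates for a second point in the plane of x. *)
Lemma circle_cover (Q : {set V}) (nu c : V -> R) :
  #|\bigcup_(x in Q | x \in planar_points) circle (plane_of x) (nu x) x (c x)|%:R
    <= #|Q|%:R * 2 :> R.
Proof.
apply: card_bigcup_const => // x _ /plane_ofP[_ wx]; rewrite ler_nat.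
exact: circle_meet wx.
Qed.

Definition circle_points rho := [set v in planar_points | norm2 v == rho].

(** Points x, y of different planes that are equinormal satisfy D x y = 2 |x|^2 and
    D x y = |x|^2 + rho, so they have squared norm rho; two points of the same plane
    occur in few cliques by [circle_cover]. *)
Lemma perp_cliques_circle a rho :
  #|cliques (equinormal D al be rho) (perp al be a) q|%:R <=
    (#|~: planar_points|%:R + q%:R * 2) * n ^+ q.-1 +
    'C(m, q)%:R / m%:R ^+ q * #|[set v in circle_points rho | weight a v == 0%R]|%:R ^+ q.
Proof.
have m0 : (0 < m)%N by exact: ltnW.
set M := [set v in _ | _]; set F := cliques _ _ _.
have FP Q : Q \in F -> [/\ Q \subset perp al be a, #|Q| = q &
   {in Q &, forall x y, x != y -> norm2 x = norm2 y /\ D x y = norm2 x + rho}].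
  rewrite inE => /and3P[QZ /eqP cQ /is_cliqueP cl]; split=> // x y xQ yQ xy.
  by have /andP[/eqP-> /eqP->] := cl x y xQ yQ xy.
pose Phi (Q : {set V}) := \bigcup_(x in Q | x \in planar_points)
  circle (plane_of x) (norm2 x) x (norm2 x + rho).
apply: le_trans (@color_split R V _ plane_of F planar_points q Phi (q%:R * 2) _ _ _ _ _) _.
- exact: ltnW.
- by rewrite mulr_ge0.
- by move=> Q /FP[].
- move=> Q x y /FP[_ _ h] QY xQ yQ xy cxy; have [e1 e2] := h x y xQ yQ xy.
  apply/bigcupP; exists x; first by rewrite !inE xy xQ; have := subsetP QY x xQ; rewrite inE.
  have [ya _] := plane_ofP (subsetP QY y yQ).
  by rewrite inE cxy ya e1 e2 e1 !eqxx.
- move=> Q cQ; apply: le_trans (circle_cover _ _ _) _.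
  by rewrite ler_wpM2r // ler_nat cQ leq_pred.
rewrite lerD2l; apply: le_trans (_ : #|cliques (fun x y => plane_of x != plane_of y) M q|%:R <= _).
  rewrite ler_nat; apply: subset_leq_card; apply/subsetP => Q.
  rewrite !inE => /andP[QF /andP[QY rb]].
  have {}QF : Q \in F by rewrite inE.
  have [QZ cQ h] := FP Q QF; rewrite rb cQ eqxx /= andbT.
  apply/subsetP => x xQ; have [y yQ yx] : exists2 y, y \in Q & y != x.
    by apply: exists_other; rewrite cQ.
  have xY := subsetP QY x xQ; have yY := subsetP QY y yQ.
  have := subsetP QZ x xQ; rewrite !inE => ->; rewrite andbT.
  move: (xY); rewrite inE => -> /=.
  rewrite eq_sym in yx; have [e1 e2] := h x y xQ yQ yx.
  have := cross_dist xY yY (is_cliqueP _ _ rb x y xQ yQ yx).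
  by rewrite e2 => /addrI ->; rewrite e1.
apply: le_trans (zykov_colors _ (m := m) m0 (leqW qm) _) _; last by rewrite expr_div_n mulrCA [X in X <= _]mulrC.
have : (#|plane_of @: M| <= #|[set~ a]|)%N; last by rewrite cardsC1 card_ord.
apply: subset_leq_card; apply/subsetP => _ /imsetP[v + ->]; rewrite !inE => /andP[/andP[vY _]].
apply: contraTneq => <-; have [] := @plane_ofP v; rewrite // inE //.
Qed.

(** A facet of v with vertices on different circles has squared side 2 rho, so its
    vertices are at that squared distance from v.  Call these points the neighbours of
    v; if v had three neighbours on each of m
    of the r circles, it would be orthogonal to m planes and have squared norm rho, that
    is, v would lie on the last circle.  Hence at least two circles have at most two
    neighbours of v each, and the other m - 1 contain at most (m - 1) x of them. *)
Lemma degree_off_circles v rho (x : R) :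
  v \notin circle_points rho -> norm2 v != 0 ->
  (forall a, #|[set w in circle_points rho | plane_of w == a]|%:R <= x) ->
  (degree D q.+1 v)%:R <=
    (#|~: circle_points rho|%:R + q%:R * 2 + r%:R * 2) * n ^+ q.-1 +
    'C(m, q)%:R / m%:R ^+ q * (m.-1%:R * x) ^+ q.
Proof.
move=> vA v0 hx; have m0 : (0 < m)%N by exact: ltnW.
have x0 : 0 <= x by apply: le_trans (hx ord0).
set A := circle_points rho in vA hx *.
have AY w : w \in A -> w \in planar_points by rewrite inE => /andP[].
have AN w : w \in A -> norm2 w = rho by rewrite inE => /andP[_ /eqP].
have q0 : (0 < q)%N by exact: ltnW.
rewrite degree_link; set F := link D q v.
have FP Q : Q \in F -> [/\ #|Q| = q, v \notin Q & exists c,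
    {in Q, forall x, D v x = c} /\ {in Q &, forall x y, x != y -> D x y = c}].
  exact: linkP.
pose Phi (Q : {set V}) := \bigcup_(y in Q | y \in planar_points)
  circle (plane_of y) rho y (D v y).
apply: le_trans (@color_split R V _ plane_of F A q Phi (q%:R * 2) q0 _ _ _ _) _.
- by rewrite mulr_ge0.
- by move=> Q /FP[].
- move=> Q y z /FP[_ _ [c [h1 h2]]] QA yQ zQ yz cyz.
  apply/bigcupP; exists y; first by rewrite !inE yz yQ; have := AY y (subsetP QA y yQ); rewrite inE.
  have zA := subsetP QA z zQ; have [za _] := plane_ofP (AY z zA).
  by rewrite inE cyz za AN // h1 // h2 // !eqxx.
- move=> Q cQ; apply: le_trans (circle_cover _ _ _) _.
  by rewrite ler_wpM2r // ler_nat cQ leq_pred.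
rewrite [X in _ <= X * _ + _]addrAC.
rewrite [leRHS](_ : _ = (#|~: A|%:R + q%:R * 2) * n ^+ q.-1 +
  (r%:R * 2 * n ^+ q.-1 + 'C(m, q)%:R / m%:R ^+ q * (m.-1%:R * x) ^+ q)); last by ring.
rewrite lerD2l; set F3 := [set Q in F | _].
pose N := [set w in A | D v w == rho + rho].
have NP w : w \in N -> w \in A /\ D v w = rho + rho.
  by rewrite inE => /andP[-> /eqP].
pose B := [set b | (2 < #|[set w in N | plane_of w == b]|)%N].
have F3N Q : Q \in F3 -> [/\ #|Q| = q, Q \subset N & is_clique (fun x y => plane_of x != plane_of y) Q].
  rewrite inE => /and3P[/FP[cQ _ [c [h1 h2]]] QA rb]; split => //.
  apply/subsetP => w wQ; have [z zQ zw] : exists2 z, z \in Q & z != w.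
    by apply: exists_other; rewrite cQ.
  have wA := subsetP QA w wQ; have zA := subsetP QA z zQ.
  rewrite inE wA h1 // -(h2 z w) //.
  by rewrite (cross_dist (AY z zA) (AY w wA) (is_cliqueP _ _ rb z w zQ wQ zw)) (AN z zA) (AN w wA) eqxx.
have wB b : b \in B -> weight b v = 0 /\ norm2 v = rho.
  rewrite inE => hb; have wv : weight b v = 0.
    apply/eqP; apply: contraTT hb => wv; rewrite -leqNgt.
    apply: leq_trans (circle_meet D_eq0 coordsP rho (rho + rho) wv).
    apply: subset_leq_card; apply/subsetP => w.
    rewrite inE => /andP[/NP[wA dw] /eqP wb].
    by have [] := plane_ofP (AY w wA); rewrite inE wb => -> _; rewrite AN // dw !eqxx.
  split => //; have /card_gt0P[w] : (0 < #|[set w in N | plane_of w == b]|)%N.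
    exact: leq_trans hb.
  rewrite inE => /andP[/NP[wA dw] /eqP wb].
  have [wpl _] := plane_ofP (AY w wA); rewrite wb in wpl.
  by move: dw; rewrite (dist_perp coordsP wpl wv) (AN w wA) => /addIr.
have cB : (#|B| <= m.-1)%N.
  have [a wa] : exists a, weight a v != 0.
    apply: contrapT => na; case/eqP: v0; apply: big1 => a _.
    by apply/eqP; apply: contrapT => wa; apply: na; exists a; exact/negP.
  have aB : a \notin B by apply: contraNN wa => /wB[-> _].
  have [b [ba bB]] : exists b, b != a /\ b \notin B.
    apply: contrapT => nb.
    have inB b : b != a -> b \in B.
      by move=> ba; apply: contraT => bB; case: nb; exists b.
    have va : in_plane a v by apply/in_planeP => b /inB /wB[].
    have [b ba] : exists b, b != a.
      have [a0|a0] := posnP a; [exists ord_max|exists ord0]; rewrite -val_eqE /= ?a0.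
        by rewrite -lt0n.
      by rewrite eq_sym -lt0n.
    case/negP: vA; rewrite inE; have [_ ->] := wB b (inB b ba); rewrite eqxx andbT.
    by apply/planar_pointsP; exists a.
  have := cardsC B; rewrite card_ord.
  have : (#|[set a; b]| <= #|~: B|)%N.
    by apply: subset_leq_card; apply/subsetP => i; rewrite !inE => /orP[]/eqP->; rewrite ?inE in aB bB *.
  by rewrite cards2 eq_sym ba; move: m0; clear; lia.
pose Nout := [set w in N | plane_of w \notin B].
pose Nin := [set w in N | plane_of w \in B].
have cout : #|Nout|%:R <= r%:R * 2 :> R.
  rewrite -natrM ler_nat; apply: leq_trans (_ : #|\bigcup_(b | b \notin B) [set w in N | plane_of w == b]| <= _)%N.
    apply: subset_leq_card; apply/subsetP => w; rewrite inE => /andP[wN wb].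
    by apply/bigcupP; exists (plane_of w) => //; rewrite inE wN eqxx.
  apply: leq_trans (card_bigcup_le _ _) _.
  apply: leq_trans (_ : \sum_(b | b \notin B) 2 <= _)%N.
    by apply: leq_sum => b; rewrite inE -leqNgt.
  by rewrite sum_nat_const leq_mul2r /= -[leqRHS]card_ord max_card.
have cin : #|Nin|%:R <= m.-1%:R * x.
  apply: le_trans (_ : #|\bigcup_(b in B | true) [set w in A | plane_of w == b]|%:R <= _).
    rewrite ler_nat; apply: subset_leq_card; apply/subsetP => w.
    rewrite inE => /andP[/NP[wA _] wb].
    by apply/bigcupP; exists (plane_of w); rewrite ?wb // inE wA eqxx.
  apply: le_trans (_ : (\sum_(b in B | true) #|[set w in A | plane_of w == b]|)%:R <= _).
    by rewrite ler_nat card_bigcup_le.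
  rewrite natr_sum; apply: le_trans (_ : \sum_(b in B | true) x <= _).
    by apply: ler_sum => b _; exact: hx.
  under eq_bigl do rewrite andbT.
  by rewrite sumr_const -[leLHS]mulr_natl ler_wpM2r // ler_nat.
pose F4 := [set Q in F3 | ~~ (Q \subset Nin)].
have c4 : #|F4|%:R <= r%:R * 2 * n ^+ q.-1.
  apply: le_trans (_ : #|Nout|%:R * n ^+ q.-1 <= _); last first.
    by rewrite ler_wpM2r // exprn_ge0 // ler0n.
  apply: card_meeting => Q; rewrite inE => /andP[/F3N[cQ QN _] /subsetPn[y yQ yB]].
  exists y => //; rewrite card_setD1_in // cQ; split => //.
  by move: yB; rewrite !inE; have := subsetP QN y yQ; rewrite !inE => -> /= ->.
apply: le_trans (_ : #|F4|%:R + #|cliques (fun x y => plane_of x != plane_of y) Nin q|%:R <= _).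
  rewrite -natrD ler_nat; apply: leq_trans (leq_card_setU _ _).
  apply: subset_leq_card; apply/subsetP => Q QF; have [cQ _ rb] := F3N Q QF.
  by rewrite in_setU [Q \in F4]inE QF [Q \in cliques _ _ _]inE cQ eqxx rb /=; case: (Q \subset Nin).
apply: lerD => //; apply: le_trans (zykov_colors _ (m := m) m0 (leqW qm) _) _.
  apply: leq_trans (_ : #|B| <= m)%N; last by apply: leq_trans cB _; exact: leq_pred.
  by apply: subset_leq_card; apply/subsetP => _ /imsetP[w + ->]; rewrite inE => /andP[].
rewrite expr_div_n mulrCA [X in X <= _]mulrC.
by rewrite ler_wpM2l ?divr_ge0 ?exprn_ge0 // lerXn2r // nnegrE // mulr_ge0.
Qed.

(** A simplex with two vertices x, y on the same circle has a third vertex z, as k > 2,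
    and D x z prescribes the distance of y to x. *)
Lemma simplices_on_circles rho :
  {in ~: circle_points rho, forall v, norm2 v = 0} ->
  #|simplices D q.+1|%:R <=
    'C(r, q.+1)%:R * (n / r%:R) ^+ q.+1 + (1 + q%:R * (q%:R * 2)) * n ^+ q.
Proof.
move=> hA; set A := circle_points rho in hA *.
have AY w : w \in A -> w \in planar_points by rewrite inE => /andP[].
have AN w : w \in A -> norm2 w = rho by rewrite inE => /andP[_ /eqP].
set F := simplices D q.+1.
pose Phi (Q : {set V}) := \bigcup_(z in Q | true) \bigcup_(x in Q | x \in planar_points)
  circle (plane_of x) rho x (D x z).
apply: le_trans (@color_split R V _ plane_of F A q.+1 Phi (q%:R * (q%:R * 2)) _ _ _ _ _) _ => //.
- by rewrite !mulr_ge0.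
- by move=> Q /simplicesP[].
- move=> Q x y /simplicesP[cQ [c hc]] QA xQ yQ xy cxy.
  have [z [zQ zx zy]] : exists z, [/\ z \in Q, z != x & z != y].
    by apply: exists_third; rewrite cQ.
  apply/bigcupP; exists z; first by rewrite !inE zy zQ.
  apply/bigcupP; exists x; first by rewrite !inE xy xQ; have := AY x (subsetP QA x xQ); rewrite inE.
  have yA := subsetP QA y yQ; have [ya _] := plane_ofP (AY y yA).
  rewrite eq_sym in zx.
  by rewrite inE cxy ya AN // !hc // !eqxx.
- move=> Q /= cQ; rewrite -cQ; apply: card_bigcup_const; first by rewrite mulr_ge0.
  by move=> z _ _; exact: circle_cover.
rewrite addrC lerD //.
  apply: le_trans (_ : #|cliques (fun x y => plane_of x != plane_of y) setT q.+1|%:R <= _).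
    rewrite ler_nat; apply: subset_leq_card; apply/subsetP => Q; rewrite !inE.
    by move=> /andP[/andP[-> _] /andP[_ ->]]; rewrite subsetT.
  rewrite /n -cardsT; apply: zykov_colors => //; first by rewrite !ltnS (leqW qm).
  by rewrite -[leqRHS]card_ord max_card.
rewrite /= ler_wpM2r ?exprn_ge0 ?ler0n // lerD2r (ler_nat R _ 1).
apply: leq_trans (centre_unique D_eq0 coordsP); apply: subset_leq_card.
by apply/subsetP => v /hA v0; rewrite inE v0.
Qed.

End Circles.

(** * Sets of large minimum degree lie on circles *)

(** Converts a lower bound on the number of cliques in a set of size z, relative to
    that of the Turan graph with m classes of size n / (m + 1), into a lower bound on z,
    linearly in the error d. *)
Lemma root_bound (R : realType) m q (kappa d n z : R) :
  (0 < m)%N -> (0 < q)%N -> 0 < kappa -> 0 <= d -> 0 < n -> 0 <= z ->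
  (kappa / m.+1%:R ^+ q - d) * n ^+ q <= kappa / m%:R ^+ q * z ^+ q ->
  m%:R / m.+1%:R * n - m.+1%:R ^+ q / kappa * d * n <= z.
Proof.
move=> m0 q0 k0 d0 n0 z0 h.
have mR : 0 < m%:R :> R by rewrite ltr0n.
have rR : 0 < m.+1%:R :> R by rewrite ltr0n.
pose y := z / n * m.+1%:R / m%:R.
have y0 : 0 <= y by rewrite !mulr_ge0 ?invr_ge0 // ltW.
have zE : z = m%:R / m.+1%:R * n * y.
  rewrite /y; move: (lt0r_neq0 mR) (lt0r_neq0 rR) (lt0r_neq0 n0).
  by move: (m%:R) (m.+1%:R) => M P hM hP hn; field; rewrite hM hP hn.
set c := m.+1%:R ^+ q / kappa * d.
have c0 : 0 <= c by rewrite mulr_ge0 // divr_ge0 ?exprn_ge0 ?ltW.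
have yq : 1 - c <= y ^+ q.
  have nq : 0 < n ^+ q by rewrite exprn_gt0.
  have rq : 0 < m.+1%:R ^+ q :> R by rewrite exprn_gt0.
  have mq : 0 < m%:R ^+ q :> R by rewrite exprn_gt0.
  rewrite -(ler_pM2l (mulr_gt0 (divr_gt0 k0 rq) nq)).
  apply: le_trans (_ : (kappa / m.+1%:R ^+ q - d) * n ^+ q <= _).
    rewrite le_eqVlt; apply/orP; left; apply/eqP; rewrite /c.
    by field; rewrite (gt_eqF rq) (gt_eqF k0).
  apply: le_trans h _; rewrite le_eqVlt; apply/orP; left; apply/eqP.
  rewrite {1}zE !exprMn exprVn; by field; rewrite (gt_eqF rq) (gt_eqF mq).
have y1 : 1 - c <= y.
  have [y1|y1] := leP 1 y; first by apply: le_trans y1; lra.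
  by apply: le_trans yq _; rewrite -[leRHS]expr1 ler_wiXn2l // ltW.
have mr1 : m%:R / m.+1%:R <= 1 :> R by rewrite ler_pdivrMr // mul1r ler_nat.
have mr0 : 0 <= m%:R / m.+1%:R :> R by rewrite divr_ge0 ?ltW.
rewrite [leRHS]zE; move: mr0 mr1; move: (m%:R / m.+1%:R) => w w0 w1.
apply: le_trans (_ : w * n * (1 - c) <= _); last by rewrite ler_wpM2l // mulr_ge0 // ltW.
rewrite mulrBr mulr1 lerD2l lerN2 -mulrA [n * c]mulrC ler_piMl //.
by rewrite mulr_ge0 // ltW.
Qed.

Section Structure.
Variables (R : realType) (V : finType) (D : V -> V -> R) (m q : nat).
Local Notation r := m.+1.
Variables (al be : 'I_r -> V -> R) (rho : 'I_r -> R).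
Hypothesis D_eq0 : forall x y, D x y = 0 -> x = y.
Hypothesis coordsP : plane_coords D al be.
Hypothesis m1 : (1 < m)%N.
Hypothesis q1 : (1 < q)%N.
Hypothesis qm : (q <= m)%N.
Let n : R := #|V|%:R.
Let kappa : R := 'C(m, q)%:R.
Let L : R := r%:R ^+ q / kappa.
Variable eps : R.
Let e2 : R := L * (3 + 4 * r%:R * L) * eps.
Hypothesis eps0 : 0 < eps.
Hypothesis e2_small : e2 <= 1 / 24.
Hypothesis eps_small : L * (3 * m%:R + 2) * eps + 2 * L * e2 < r%:R^-1.
Hypothesis n_large1 : 2 <= r%:R * L * eps * n.
Hypothesis n_large2 : q%:R * 2 + r%:R * 2 <= eps * n.
Hypothesis n0 : 0 < n.
Hypothesis cliques_large : forall a,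
  (kappa / r%:R ^+ q - 2 * eps) * n ^+ q <=
    #|cliques (equinormal D al be (rho a)) (perp al be a) q|%:R.
Hypothesis perp_large : forall a,
  m%:R / r%:R * n - L * (3 * eps) * n <= #|perp al be a|%:R.
Hypothesis degree_large : forall v,
  (kappa / r%:R ^+ q - eps) * n ^+ q <= (degree D q.+1 v)%:R.

Let m0 : (0 < m)%N. Proof. exact: ltnW. Qed.
Let q0 : (0 < q)%N. Proof. exact: ltnW. Qed.
Let kappa0 : 0 < kappa. Proof. by rewrite ltr0n bin_gt0. Qed.
Let mR : 0 < m%:R :> R. Proof. by rewrite ltr0n. Qed.
Let rR : 0 < r%:R :> R. Proof. by rewrite ltr0n. Qed.
Let rE : r%:R = m%:R + 1 :> R. Proof. by rewrite -natr1. Qed.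
Let m2R : 2 <= m%:R :> R. Proof. by rewrite (ler_nat R 2). Qed.
Let L0 : 0 < L. Proof. by rewrite divr_gt0 // exprn_gt0. Qed.
Let nqE : n ^+ q = n * n ^+ q.-1. Proof. by rewrite -exprS prednK. Qed.
Let nq0 : 0 <= n ^+ q.-1. Proof. by rewrite exprn_ge0 // ltW. Qed.

Let rLe0 : 0 <= r%:R * L * eps.
Proof. exact: mulr_ge0 (mulr_ge0 (ltW rR) (ltW L0)) (ltW eps0). Qed.
Let e2_0 : 0 <= e2.
Proof.
apply: mulr_ge0 (ltW eps0); apply: mulr_ge0 (ltW L0) _.
by have := mulr_ge0 (ltW rR) (ltW L0); lra.
Qed.

(* The numeral m.+1 is made opaque, as field would expand it to m + 1. *)
Ltac rfield :=
  move: (lt0r_neq0 rR); move: (m.+1%:R);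
  let P := fresh in let hP := fresh in intros P hP; field; exact hP.

Local Notation circles := (circle_points al be).
Local Notation weight := (weight al be).

Let circles_planar x v : v \in circles x -> v \in planar_points al be.
Proof. by rewrite inE => /andP[]. Qed.

Lemma compl_card (A : {set V}) : #|~: A|%:R = n - #|A|%:R.
Proof. by rewrite /n -(cardsC A) natrD addrC addKr. Qed.

Lemma nonplanar_few : #|~: planar_points al be|%:R <= 4 * r%:R * L * eps * n.
Proof.
have := planar_points_large D_eq0 coordsP (erefl r) m0 perp_large.
have -> : m.-1%:R = m%:R - 1 :> R.
  by rewrite -[in RHS](prednK m0) -natr1 addrK.
rewrite compl_card -/n.
have -> : r%:R * (m%:R / r%:R * n - L * (3 * eps) * n) =
    m%:R * n - 3 * (r%:R * L * eps * n) by rfield.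
have := n_large1; lra.
Qed.

Let M a := [set v in circles (rho a) | weight a v == 0].

Lemma circle_large a : m%:R / r%:R * n - e2 * n <= #|M a|%:R.
Proof.
have := @root_bound R m q kappa (3 * eps + 4 * r%:R * L * eps) n #|M a|%:R m0 q0 kappa0.
have -> : r%:R ^+ q / kappa * (3 * eps + 4 * r%:R * L * eps) = e2.
  by rewrite -/L /e2; ring.
apply => //.
  by have := rLe0; have := eps0; lra.
have := @perp_cliques_circle R V D m al be D_eq0 coordsP m1 q q1 qm a (rho a).
rewrite -/n -/kappa -/(M a) => h1.
have h2 := cliques_large a.
have h3 : (#|~: planar_points al be|%:R + q%:R * 2) * n ^+ q.-1 <=
    (4 * r%:R * L * eps + eps) * n ^+ q.
  rewrite nqE mulrA ler_wpM2r // mulrDl lerD ?nonplanar_few //.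
  by apply: le_trans n_large2; rewrite lerDl mulr_ge0.
have := le_trans h2 (le_trans h1 (lerD h3 (lexx _))); lra.
Qed.

(** For m >= 2, two sets of at least about m n / (m + 1) points have a common point. *)
Lemma radii_equal a b : rho a = rho b.
Proof.
have : (0 < #|M a :&: M b|)%N.
  rewrite lt0n; apply/eqP => I0; have := cardsUI (M a) (M b); rewrite I0 addn0 => h.
  have : #|M a|%:R + #|M b|%:R <= n by rewrite -natrD -h ler_nat max_card.
  have mr : 2 / 3 * n <= m%:R / r%:R * n.
    by rewrite ler_wpM2r ?(ltW n0) // ler_pdivlMr // rE; have := m2R; lra.
  have he : e2 * n <= 1 / 24 * n by rewrite ler_wpM2r // ltW.
  have := circle_large a; have := circle_large b; have := n0; move: mr he.
  move: (m%:R / r%:R * n) (e2 * n) => w y; lra.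
by case/card_gt0P => v; rewrite !inE => /andP[/andP[/andP[_ /eqP <-] _] /andP[/andP[_ /eqP <-]]].
Qed.

Let rho0 := rho ord0.

(** Each point of the circles is orthogonal to at most m planes. *)
Lemma off_circles_few : #|~: circles rho0|%:R <= 2 * e2 * n.
Proof.
have h : (\sum_a #|M a| <= m * #|circles rho0|)%N.
  under eq_bigr do rewrite -sum1_card big_mkcond.
  rewrite exchange_big /= mulnC -sum_nat_const [leqRHS]big_mkcond /=.
  apply: leq_sum => v _; rewrite -big_mkcond sum1dep_card.
  case: ifP => [vA|vA]; last first.
    rewrite leqn0 cards_eq0; apply/eqP/setP => a; rewrite in_set in_set0.
    by apply/negP; rewrite inE (radii_equal a ord0) vA.
  have [_ wv] := plane_ofP (circles_planar vA).
  have : (#|[set a | v \in M a]| <= #|[set~ plane_of al be v]|)%N.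
    apply: subset_leq_card; apply/subsetP => a; rewrite !inE => /andP[_].
    by apply: contraTneq => ->.
  by rewrite cardsC1 card_ord.
have : r%:R * (m%:R / r%:R * n - e2 * n) <= m%:R * #|circles rho0|%:R.
  rewrite -natrM; apply: le_trans (_ : (\sum_a #|M a|)%:R <= _); last by rewrite ler_nat.
  rewrite natr_sum; apply: le_trans (_ : \sum_(a < r) (m%:R / r%:R * n - e2 * n) <= _).
    by rewrite sumr_const card_ord -[leRHS]mulr_natl.
  by apply: ler_sum => a _; exact: circle_large.
have -> : r%:R * (m%:R / r%:R * n - e2 * n) = m%:R * n - r%:R * e2 * n.
  by rfield.
rewrite compl_card => h1; rewrite -(ler_pM2l mR).
have : r%:R * e2 * n <= 2 * m%:R * (e2 * n).
  rewrite -mulrA; apply: ler_wpM2r; first exact: mulr_ge0 e2_0 (ltW n0).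
  by rewrite rE; have := m2R; lra.
lra.
Qed.

(** By [degree_off_circles], with the bound on the number of points of each circle that
    [perp_large] implies, any other point would have too small a degree. *)
Lemma all_on_circles : {in ~: circles rho0, forall v, norm2 al be v = 0}.
Proof.
move=> v; rewrite in_setC => vA; apply/eqP; apply: contraT => v0.
pose x := n / r%:R + L * (3 * eps) * n.
have hx a : #|[set w in circles rho0 | plane_of al be w == a]|%:R <= x.
  apply: le_trans (_ : #|~: perp al be a|%:R <= _).
    rewrite ler_nat; apply: subset_leq_card; apply/subsetP => w.
    rewrite inE => /andP[wA /eqP wa]; rewrite !inE.
    by have [_] := plane_ofP (circles_planar wA); rewrite wa.
  rewrite compl_card /x; have := perp_large a.
  have -> : n / r%:R = n - m%:R / r%:R * n.
    have -> : m%:R = r%:R - 1 :> R by rewrite rE addrK.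
    by rfield.
  by move: (m%:R / r%:R * n) => w; lra.
have x0 : 0 <= x.
  rewrite /x addr_ge0 ?divr_ge0 ?(ltW n0) ?(ltW rR) //.
  by apply: mulr_ge0 (ltW n0); apply: mulr_ge0 (ltW L0) _; have := eps0; lra.
have := @root_bound R m q kappa (2 * eps + 2 * e2) n (m.-1%:R * x) m0 q0 kappa0.
have big : (kappa / r%:R ^+ q - (2 * eps + 2 * e2)) * n ^+ q <=
    kappa / m%:R ^+ q * (m.-1%:R * x) ^+ q.
  have h1 := degree_large v.
  have := degree_off_circles D_eq0 coordsP m1 q1 qm vA v0 hx.
  rewrite -/n -/kappa => h2.
  have h3 : (#|~: circles rho0|%:R + q%:R * 2 + r%:R * 2) * n ^+ q.-1 <=
      (2 * e2 + eps) * n ^+ q.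
    rewrite nqE mulrA ler_wpM2r // -addrA mulrDl lerD ?off_circles_few //.
  have := le_trans h1 (le_trans h2 (lerD h3 (lexx _))); lra.
have d0 : 0 <= 2 * eps + 2 * e2 by have := e2_0; have := eps0; lra.
have mx0 : 0 <= m.-1%:R * x by rewrite mulr_ge0.
move=> /(_ d0 n0 mx0 big); rewrite -/L.
have -> : m.-1%:R = m%:R - 1 :> R.
  by rewrite -[in RHS](prednK m0) -natr1 addrK.
rewrite /x leNgt => /negP; case.
rewrite -subr_gt0.
have -> : m%:R / r%:R * n - L * (2 * eps + 2 * e2) * n -
    (m%:R - 1) * (n / r%:R + L * (3 * eps) * n) =
    (r%:R^-1 - (L * (3 * m%:R + 2) * eps + 2 * L * e2) + 3 * L * eps) * n.
  by rfield.
apply: mulr_gt0 n0; apply: addr_gt0; first by rewrite subr_gt0.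
by apply: mulr_gt0 eps0; apply: mulr_gt0 L0.
Qed.

End Structure.

Lemma degree_total (R : realType) (V : finType) (D : V -> V -> R) k :
  (\sum_v degree D k v = k * #|simplices D k|)%N.
Proof.
transitivity (\sum_(S in simplices D k) #|S|)%N.
  under eq_bigr do rewrite /degree -sum1dep_card big_mkcondr /=.
  rewrite exchange_big; apply: eq_bigr => S _ /=.
  by rewrite -big_mkcond sum1_card.
rewrite mulnC -sum_nat_const; apply: eq_bigr => S.
by case/simplicesP.
Qed.

(** By this gap, sets in which all degrees are large have more simplices than m classes
    would allow. *)
Lemma turan_density_lt (R : realType) m k : (0 < m)%N -> (2 <= k <= m.+1)%N ->
  'C(m, k)%:R / m%:R ^+ k < 'C(m.+1, k)%:R / m.+1%:R ^+ k :> R.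
Proof.
move=> m0 /andP[k2 km].
pose g m s : R := 'C(m, s)%:R / m%:R ^+ s.
have gS m' s : (0 < m')%N -> (s <= m')%N ->
    s.+1%:R * g m' s.+1 = g m' s * (1 - s%:R / m'%:R).
  by move=> m'0 sm'; have := turan_density_step (1 : R) m'0 sm'; rewrite !expr_div_n !expr1n !mul1r => <-.
have g1 m' : (0 < m')%N -> g m' 1 = 1.
  by move=> m'0; rewrite /g bin1 expr1 divff // pnatr_eq0 -lt0n.
have inv_lt : m.+1%:R^-1 < m%:R^-1 :> R by rewrite ltf_pV2 ?posrE ?ltr0n // ltr_nat.
suff : forall s, (s.+2 <= m.+1)%N -> g m s.+2 < g m.+1 s.+2.
  by move=> h; case: k k2 km => [|[|k]] // _ km; exact: h.
elim=> [|s IH] sm.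
  rewrite -(ltr_pM2l (ltr0Sn R 1)) !gS // !g1 // !mul1r ltrD2l ltrN2 //.
have {}IH := IH (ltnW sm).
rewrite -(ltr_pM2l (ltr0Sn R s.+2)) !gS //; last exact: ltnW.
have fac : 1 - s.+2%:R / m%:R <= 1 - s.+2%:R / m.+1%:R :> R.
  by rewrite lerD2l lerN2 ler_wpM2l // ltW.
have fac0 : 0 < 1 - s.+2%:R / m.+1%:R :> R.
  by rewrite subr_gt0 ltr_pdivrMr ?ltr0n // mul1r ltr_nat.
apply: le_lt_trans (_ : g m s.+2 * (1 - s.+2%:R / m.+1%:R) < _).
  by rewrite ler_wpM2l // /g divr_ge0 ?exprn_ge0.
by rewrite ltr_pM2r.
Qed.

(** The derivative of C(r, k) (n/r)^k is C(m, q) (n/r)^q, for r = m + 1 and k = q + 1. *)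
Lemma turan_density_diag (R : realType) m q :
  q.+1%:R * ('C(m.+1, q.+1)%:R / m.+1%:R ^+ q.+1) = 'C(m, q)%:R / m.+1%:R ^+ q :> R.
Proof.
rewrite mulrA -natrM -mul_bin_diag natrM exprS.
have P0 : m.+1%:R != 0 :> R by rewrite pnatr_eq0.
have Q0 : m.+1%:R ^+ q != 0 :> R by rewrite expf_neq0.
by rewrite invfM mulrACA mulrV ?unitfE // mul1r.
Qed.

Lemma circles_structure (R : realType) m q :
  (1 < q <= m)%N ->
  exists2 eps : R, 0 < eps & exists N, forall V : finType, (N <= #|V|)%N ->
    forall D : V -> V -> R, (forall x y, D x y = D y x) ->
    (forall x y, D x y = 0 -> x = y) -> planar m.+1 D ->
    (forall v, ('C(m, q)%:R / m.+1%:R ^+ q - eps) * #|V|%:R ^+ q <= (degree D q.+1 v)%:R) ->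
    exists (al be : 'I_m.+1 -> V -> R) rho, plane_coords D al be /\
      {in ~: circle_points al be rho, forall v, norm2 al be v = 0}.
Proof.
move=> /andP[q1 qm].
have m1 : (1 < m)%N by exact: leq_trans qm.
have m0 : (0 < m)%N by exact: ltnW.
have q0 : (0 < q)%N by exact: ltnW.
pose r := m.+1.
pose kappa : R := 'C(m, q)%:R.
have kappa0 : 0 < kappa by rewrite ltr0n bin_gt0.
pose L : R := r%:R ^+ q / kappa.
have L0 : 0 < L by rewrite divr_gt0 // exprn_gt0 // ltr0n.
have rR : 0 < r%:R :> R by rewrite ltr0n.
have mR : 0 < m%:R :> R by rewrite ltr0n.
pose gap : R := 'C(r, q.+1)%:R / r%:R ^+ q.+1 - 'C(m, q.+1)%:R / m%:R ^+ q.+1.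
have qm2 : (2 <= q.+1 <= m.+1)%N by apply/andP.
have gap0 : 0 < gap by rewrite subr_gt0; exact: turan_density_lt.
pose K : R := L * (3 + 4 * r%:R * L).
have K0 : 0 < K by apply: (mulr_gt0 L0); have := mulr_gt0 rR L0; lra.
(* Up to K eps n, the points on circles that are orthogonal to a given plane number at
   least m n / r.  E1 makes two such sets meet, while E2 and E3 make the degree of a
   point off the circles too small. *)
pose E1 : R := (24 * K)^-1.
pose E2 : R := (4 * r%:R * (L * (3 * m%:R + 2)))^-1.
pose E3 : R := (8 * r%:R * L * K)^-1.
have E10 : 0 < E1 by rewrite invr_gt0; exact: mulr_gt0.
have E20 : 0 < E2.
  rewrite invr_gt0; apply: mulr_gt0; first exact: mulr_gt0.
  by apply: (mulr_gt0 L0); have := mR; lra.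
have E30 : 0 < E3.
  rewrite invr_gt0; apply: (fun h => mulr_gt0 h K0); apply: (fun h => mulr_gt0 h L0).
  exact: mulr_gt0.
pose eps := Num.min (gap / 2) (Num.min E1 (Num.min E2 E3)).
have eps0 : 0 < eps by rewrite !lt_min E10 E20 E30 divr_gt0.
have [ge1 [ge2 [ge3 ge4]]] : eps <= gap / 2 /\ eps <= E1 /\ eps <= E2 /\ eps <= E3.
  by split; [|split; [|split]]; rewrite /eps !ge_min lexx ?orbT.
exists eps => //.
(* With t >= 2 / eps, the facets that belong to at most two points of a class are
   negligible among those counted with its t points. *)
have [t tP] := upper_nat (Num.max 3 (2 / eps)).
have := tP t (leqnn _); rewrite ge_max => /andP[t3 te].
have {}t3 : (2 < t)%N by rewrite -(ler_nat R).
have {}te : 2 <= t%:R * eps by move: te; rewrite ler_pdivrMr.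
have gap3 : 0 < gap / 3 by rewrite divr_gt0.
have k3 : (3 <= q.+1 <= m.+1)%N by rewrite !ltnS q1 qm.
have [N1 N1P] := classes_exist m0 k3 (leq_trans (isT : 0 < 3)%N t3) gap3.
have qm' : (0 < q <= m.+1)%N by rewrite q0 leqW.
have [N2 N2P] := perp_cliques_upper m0 qm' eps0.
have [N3 N3P] := upper_nat (2 / (r%:R * L * eps)).
have [N4 N4P] := upper_nat ((q%:R * 2 + r%:R * 2) / eps).
exists (maxn (maxn 1 N1) (maxn N2 (maxn N3 N4))) => V.
rewrite !geq_max => /andP[/andP[V1 VN1] /and3P[VN2 VN3 VN4]] D D_sym D_eq0 pl hdeg.
pose n : R := #|V|%:R.
have n0 : 0 < n by rewrite ltr0n.
have nq : 0 < n ^+ q by rewrite exprn_gt0.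
have [T [cT eqT]] : exists T : 'I_m.+1 -> {set V},
    (forall a, #|T a| = t) /\ equidistant_classes D T.
  apply: N1P => //; rewrite -/n.
  have S0 := ltr0Sn R q; rewrite -(ltr_pM2l S0) -[X in _ < X]natrM -degree_total natr_sum.
  apply: lt_le_trans (_ : \sum_(v : V) ('C(m, q)%:R / m.+1%:R ^+ q - eps) * n ^+ q <= _); last first.
    by apply: ler_sum.
  rewrite sumr_const -[X in _ < X]mulr_natl -/n [n ^+ q.+1]exprS [ltLHS]mulrA [ltRHS]mulrCA.
  have -> : q.+1%:R * ('C(m, q.+1)%:R / m%:R ^+ q.+1 + gap / 3) =
      'C(m, q)%:R / m.+1%:R ^+ q - q.+1%:R * (gap * (2 / 3)).
    rewrite -turan_density_diag /gap /r.
    move: ('C(m.+1, q.+1)%:R / _) ('C(m, q.+1)%:R / _) (q.+1%:R : R) => x y z; by field.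
  rewrite ltr_pM2r; last exact: mulr_gt0.
  rewrite ltrD2l ltrN2.
  apply: le_lt_trans ge1 _; apply: lt_le_trans (_ : gap * (2 / 3) <= _); first lra.
  by rewrite ler_peMl ?ler1n //; apply: ltW; apply: (mulr_gt0 gap0); lra.
have cT2 a : (2 < #|T a|)%N by rewrite cT.
have [al [be [rho [coordsP Tpl Trho]]]] := planar_circles (ltnW m1 : 1 < m.+1)%N pl cT2 eqT.
have TP a : {in T a, forall u, in_plane al be a u /\ norm2 al be u = rho a}.
  by move=> u ua; rewrite (Tpl a) ?(Trho a).
have cl_large a : (kappa / r%:R ^+ q - 2 * eps) * n ^+ q <=
    #|cliques (equinormal D al be (rho a)) (perp al be a) q|%:R.
  have t0 : 0 < t%:R :> R by rewrite ltr0n; exact: leq_trans t3.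
  have h1 := degree_sum D_sym D_eq0 coordsP q1 (TP a).
  have h2 : t%:R * ((kappa / r%:R ^+ q - eps) * n ^+ q) <= \sum_(u in T a) (degree D q.+1 u)%:R.
    by rewrite mulr_natl -(cT a) -sumr_const; apply: ler_sum => u _; exact: hdeg.
  rewrite -(ler_pM2l t0); move: (le_trans h2 h1); rewrite cT -/n.
  have : 2 * n ^+ q <= t%:R * eps * n ^+ q by rewrite ler_wpM2r // ltW.
  lra.
have perp_large a : m%:R / r%:R * n - L * (3 * eps) * n <= #|perp al be a|%:R.
  have e30 : 0 <= 3 * eps by rewrite mulr_ge0 // ltW.
  apply: (root_bound m0 q0 kappa0 e30 n0) => //.
  have cT1 : (1 < #|T a|)%N by exact: ltnW.
  have := N2P V VN2 D D_sym D_eq0 pl al be coordsP a (rho a) (T a) cT1 (TP a).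
  rewrite -/n -/kappa => h; have := le_trans (cl_large a) h; lra.
exists al, be, (rho ord0); split => //.
apply: (@all_on_circles R V D m q al be rho D_eq0 coordsP m1 q1 qm eps) => //.
- rewrite -/kappa -/L -/K -[leRHS](_ : K * E1 = _); first by rewrite ler_wpM2l // ltW.
  by rewrite /E1; field; rewrite gt_eqF.
- rewrite -/kappa -/L -/K -/r.
  apply: le_lt_trans (_ : L * (3 * m%:R + 2) * E2 + 2 * L * (K * E3) < _).
    apply: lerD; apply: ler_wpM2l => //.
    - by apply: ltW; apply: (mulr_gt0 L0); have := mR; lra.
    - by apply: ltW; apply: (fun h => mulr_gt0 h L0).
    - by apply: ler_wpM2l => //; exact: ltW.
  rewrite (_ : L * _ * E2 = r%:R^-1 / 4); last first.
    have F0 : 3 * m%:R + 2 != 0 :> R by rewrite gt_eqF // addr_gt0 // mulr_gt0.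
    rewrite /E2; move: (lt0r_neq0 rR) (lt0r_neq0 L0) F0.
    move: (r%:R : R) (3 * m%:R + 2) => P F hP hL hF; field; by rewrite hP hL hF.
  rewrite (_ : 2 * L * _ = r%:R^-1 / 4); last first.
    rewrite /E3; move: (lt0r_neq0 rR) (lt0r_neq0 L0) (lt0r_neq0 K0).
    move: (r%:R : R) => P hP hL hK; field; by rewrite hP hL hK.
  have : 0 < r%:R^-1 :> R by rewrite invr_gt0.
  lra.
- have c0 : 0 < r%:R * L * eps by exact: mulr_gt0 (mulr_gt0 rR L0) eps0.
  by have := N3P _ VN3; rewrite ler_pdivrMr // [leRHS]mulrC.
- by have := N4P _ VN4; rewrite ler_pdivrMr // [leRHS]mulrC.
Qed.

(** * The upper bound by removal of points *)

Lemma simplices_avoiding (R : realType) (V : finType) (D : V -> V -> R) k v :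
  (#|[set S in simplices D k | v \notin S]| <=
   #|simplices (fun x y : {w | w != v} => D (val x) (val y)) k|)%N.
Proof.
pose pre (S : {set V}) : {set {w | w != v}} := val @^-1: S.
have preK (S : {set V}) : v \notin S -> val @: pre S = S.
  move=> vS; apply/setP => x; apply/imsetP/idP => [[y + ->]|xS]; first by rewrite inE.
  have xv : x != v by apply: contraNneq vS => <-.
  by exists (Sub x xv); rewrite ?inE SubK.
rewrite -(card_in_imset (f := pre)); last first.
  by move=> S S'; rewrite !inE => /andP[_ /preK {2}<-] /andP[_ /preK {2}<-] ->.
apply: subset_leq_card; apply/subsetP => _ /imsetP[S + ->].
rewrite inE => /andP[/simplicesP[cS [c hc]] vS]; apply/simplicesP; split.
  by rewrite -cS -[in RHS](preK S vS) card_imset //; exact: val_inj.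
exists c => x y; rewrite !inE => xS yS xy; apply: hc => //.
Qed.

Lemma simplices_degree (R : realType) (V : finType) (D : V -> V -> R) k v :
  (#|simplices D k| <=
   #|simplices (fun x y : {w | w != v} => D (val x) (val y)) k| + degree D k v)%N.
Proof.
apply: leq_trans (leq_add (simplices_avoiding D k v) (leqnn _)).
apply: leq_trans (leq_card_setU _ _); apply: subset_leq_card; apply/subsetP => S hS.
by rewrite in_setU !inE; move: hS; rewrite inE => -> /=; case: (v \in S).
Qed.

Lemma expr_succ_ge (R : realFieldType) (y : R) s : 0 <= y ->
  y ^+ s.+1 + s.+1%:R * y ^+ s <= (y + 1) ^+ s.+1.
Proof.
move=> y0; elim: s => [|s IH]; first by rewrite !expr1 expr0 mulr1.
rewrite [leRHS]exprS; apply: le_trans (ler_wpM2l _ IH); last by rewrite addr_ge0.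
rewrite -subr_ge0.
have -> : (y + 1) * (y ^+ s.+1 + s.+1%:R * y ^+ s) - (y ^+ s.+2 + s.+2%:R * y ^+ s.+1) =
    s.+1%:R * y ^+ s.
  by rewrite !exprS -[s.+2%:R]natr1; move: (s.+1%:R : R) (y ^+ s) => a b; ring.
by rewrite mulr_ge0 // exprn_ge0.
Qed.

Lemma expr_pred_ge (R : realFieldType) (x : R) s : 1 <= x ->
  x ^+ s.+1 - s.+1%:R * x ^+ s <= (x - 1) ^+ s.+1.
Proof.
move=> x1; have x0 : 0 <= x by apply: le_trans x1.
elim: s => [|s IH]; first by rewrite !expr1 expr0 mulr1.
rewrite [leRHS]exprS; apply: le_trans (ler_wpM2l _ IH); last by rewrite subr_ge0.
rewrite -subr_ge0.
have -> : (x - 1) * (x ^+ s.+1 - s.+1%:R * x ^+ s) - (x ^+ s.+2 - s.+2%:R * x ^+ s.+1) =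
    s.+1%:R * x ^+ s.
  by rewrite !exprS -[s.+2%:R]natr1; move: (s.+1%:R : R) (x ^+ s) => a b; ring.
by rewrite mulr_ge0 // exprn_ge0.
Qed.

(** Removal of a point of degree below (phi - eps) n^q is compatible with the bound,
    since the increment of C(r, k) (n/r)^k from n - 1 to n is at least phi (n - 1)^q. *)
Lemma simplices_upper (R : realType) m q : (1 < q <= m)%N ->
  exists2 C : R, 0 < C & forall (V : finType) (p : V -> 'rV[R]_(m.+1 + m.+1)),
    injective p ->
    #|simplices (fun x y => sqdist (p x) (p y)) q.+1|%:R <=
      'C(m.+1, q.+1)%:R * (#|V|%:R / m.+1%:R) ^+ q.+1 + C * #|V|%:R ^+ q.
Proof.
move=> q1m; have /andP[q1 qm] := q1m.
have m1 : (1 < m)%N by exact: leq_trans qm.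
have q0 : (0 < q)%N by exact: ltnW.
have [eps eps0 [N1 N1P]] := @circles_structure R m q q1m.
pose phi : R := 'C(m, q)%:R / m.+1%:R ^+ q.
have phi0 : 0 <= phi by rewrite divr_ge0 ?exprn_ge0.
pose c : R := 'C(m.+1, q.+1)%:R / m.+1%:R ^+ q.+1.
have c0 : 0 <= c by rewrite divr_ge0 ?exprn_ge0.
have cphi : q.+1%:R * c = phi by rewrite /c turan_density_diag.
have [N2 N2P] := upper_nat (phi * q%:R / eps).
pose N := maxn 1 (maxn N1 N2).
pose C : R := 1 + q%:R * (q%:R * 2) + N%:R.
have qq0 : 0 <= q%:R * (q%:R * 2) :> R by rewrite !mulr_ge0.
have C0 : 0 < C by rewrite /C; have := ler0n R N; have := qq0; lra.
have fE (n : R) : 'C(m.+1, q.+1)%:R * (n / m.+1%:R) ^+ q.+1 = c * n ^+ q.+1.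
  by rewrite expr_div_n mulrCA mulrC.
exists C => // V; move cV : #|V| => n; elim: n V cV => [|n IH] V cV p p_inj.
  rewrite [simplices _ _](_ : _ = set0) ?cards0.
    apply: addr_ge0; first by rewrite mulr_ge0 // exprn_ge0 // divr_ge0.
    by apply: mulr_ge0 (ltW C0) _; rewrite exprn_ge0.
  apply/setP => S; rewrite in_set0.
  by apply/negP => /simplicesP[cS _]; have := max_card S; rewrite cS cV.
set D := fun x y => sqdist (p x) (p y).
have D_sym x y : D x y = D y x by exact: sqdist_sym.
have D_eq0 x y : D x y = 0 -> x = y by move=> /sqdist_eq0 /p_inj.
rewrite fE; pose x : R := n.+1%:R.
have x1 : 1 <= x by rewrite /x ler1n.
have x0 : 0 <= x by apply: le_trans x1.
have [ltN|leN] := ltnP n.+1 N.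
  apply: le_trans (_ : C * x ^+ q <= _); last by rewrite lerDr mulr_ge0 ?exprn_ge0.
  apply: le_trans (_ : x ^+ q.+1 <= _).
    rewrite /x -natrX ler_nat -cV; apply: leq_trans (card_subsets_leq V q.+1).
    by apply: subset_leq_card; apply/subsetP => S; rewrite !inE => /andP[].
  rewrite exprS ler_wpM2r ?exprn_ge0 // /C /x.
  have : n.+1%:R <= N%:R :> R by rewrite ler_nat ltnW.
  by have := qq0; lra.
move: leN; rewrite /N !geq_max => /and3P[_ leN1 leN2].
have [large|[v small]] : (forall v, (phi - eps) * x ^+ q <= (degree D q.+1 v)%:R) \/
    exists v, (degree D q.+1 v)%:R < (phi - eps) * x ^+ q.
  have [h|h] := pselect (forall v, (phi - eps) * x ^+ q <= (degree D q.+1 v)%:R).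
    by left.
  right; apply: contrapT => nh; apply: h => v; rewrite leNgt; apply/negP => hv.
  by apply: nh; exists v.
  have pl : planar m.+1 D by apply: planar_rV => //; exact: ltnW.
  have VN : (N1 <= #|V|)%N by rewrite cV.
  have [|al [be [rho [coordsP hc]]]] := N1P V VN D D_sym D_eq0 pl.
    by move=> v; rewrite cV; exact: large.
  have := simplices_on_circles D_eq0 coordsP q1 qm hc; rewrite cV fE => h.
  apply: le_trans h _; rewrite lerD2l ler_wpM2r ?exprn_ge0 //.
  by rewrite /C lerDl.
have cV' : #|{: {w | w != v}}| = n.
  by rewrite card_sig -[n]/(n.+1.-1) -cV (cardC1 v).
have := IH _ cV' (fun w => p (val w)) (inj_comp p_inj val_inj); rewrite fE => h1.
have h2 : #|simplices D q.+1|%:R <= c * n%:R ^+ q.+1 + C * n%:R ^+ q + (phi - eps) * x ^+ q.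
  apply: le_trans (_ : (#|simplices (fun x y : {w | w != v} => D (val x) (val y)) q.+1| +
    degree D q.+1 v)%:R <= _).
    by rewrite ler_nat simplices_degree.
  by rewrite natrD lerD // ltW.
apply: le_trans h2 _; rewrite -/x; have nx : n%:R = x - 1 :> R by rewrite /x -natr1 addrK.
have n0 : 0 <= n%:R :> R by [].
have e1 := expr_succ_ge q n0; rewrite nx subrK -nx in e1.
have e2 : phi * x ^+ q - eps * x ^+ q <= phi * n%:R ^+ q.
  have := @expr_pred_ge R x q.-1 x1; rewrite prednK // -nx => h.
  apply: le_trans (ler_wpM2l phi0 h); rewrite mulrBr lerD2l lerN2.
  have -> : x ^+ q = x * x ^+ q.-1 by rewrite -exprS prednK.
  rewrite !mulrA ler_wpM2r ?exprn_ge0 //.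
  by have := N2P _ leN2; rewrite ler_pdivrMr // [leRHS]mulrC.
have e3 : n%:R ^+ q <= x ^+ q by rewrite lerXn2r ?nnegrE // nx lerBlDr lerDl.
have e4 : c * n%:R ^+ q.+1 + phi * n%:R ^+ q <= c * x ^+ q.+1.
  rewrite -cphi; have := ler_wpM2l c0 e1.
  by rewrite mulrDr [c * (q.+1%:R * _)]mulrCA [q.+1%:R * (c * _)]mulrA.
have := ler_wpM2l (ltW C0) e3.
by move: e2 e4; rewrite mulrBl; lra.
Qed.

(** * Point sets as images of finite types *)

Section Bridge.
Local Open Scope fset_scope.
Variables (R : realType) (d : nat).

Lemma edist_sqdist (x y : 'rV[R]_d) : edist x y ^+ 2 = sqdist x y.
Proof. by rewrite sqr_sqrtr // sumr_ge0 // => i _; rewrite sqr_ge0. Qed.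

Lemma num_simplices_le (A : {fset 'rV[R]_d}) k :
  (num_simplices k A <= #|simplices (fun x y : A => sqdist (val x) (val y)) k|)%N.
Proof.
rewrite /num_simplices; set S := [fset B in _ | _].
have SP B : B \in S -> B `<=` A /\ regular_simplex k B.
  by rewrite !inE /= fpowersetE => /andP[-> /asboolP].
rewrite cardE -(size_map (fsub A) S); apply: uniq_leq_size.
  rewrite map_inj_in_uniq ?fset_uniq // => B C /SP[sB _] /SP[sC _]; exact: fsub_inj.
move=> _ /mapP[B /SP[sB [cB [l hl]]] ->]; rewrite mem_enum; apply/simplicesP.
split; first by rewrite card_fsub // cB.
exists (l ^+ 2) => x y; rewrite !in_fsub => xB yB xy.
by rewrite -edist_sqdist hl.
Qed.

Lemma num_simplices_ge (V : finType) (p : V -> 'rV[R]_d) k : injective p ->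
  (#|simplices (fun x y => sqdist (p x) (p y)) k| <=
    num_simplices k [fset p x | x in V])%N.
Proof.
move=> p_inj; set A := [fset p x | x in V].
pose img (S : {set V}) := [fset p x | x in S].
have img_inj : injective img.
  move=> S S' /fsetP E; apply/setP => x; have := E (p x).
  have mem_img (U : {set V}) : (p x \in img U) = (x \in U).
    apply/imfsetP/idP => [[y yU /p_inj ->]//|xU]; by exists x.
  by rewrite !mem_img.
rewrite cardE -(size_map img) /num_simplices; apply: uniq_leq_size.
  by rewrite map_inj_uniq ?enum_uniq.
move=> _ /mapP[S + ->]; rewrite mem_enum => /simplicesP[cS [c hc]].
rewrite !inE /= fpowersetE; apply/andP; split.
  by apply/fsubsetP => _ /imfsetP[x _ ->]; apply/imfsetP; exists x.
apply/asboolP; split; first by rewrite card_imfset // -cardE.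
exists (Num.sqrt c) => _ _ /imfsetP[x /= xS ->] /imfsetP[y /= yS ->] xy.
by rewrite -(hc x y xS yS) //; apply: contraNneq xy => ->.
Qed.

End Bridge.

(** * Cliques of multipartite graphs *)

Section Multipartite.
Variables (V I : finType) (col : V -> I).
Let e : rel V := fun x y => col x != col y.

Lemma card_color_classes (Z : {set V}) (B : {set I}) Q :
  {in B, forall b, Q <= #|[set v in Z | col v == b]|}%N ->
  (#|B| * Q <= #|[set v in Z | col v \in B]|)%N.
Proof.
move=> hB; rewrite -sum_nat_const -sum1dep_card.
rewrite (partition_big col (mem B)) /=; last by move=> v /andP[].
apply: leq_sum => b bB; apply: leq_trans (hB b bB) _; rewrite -sum1dep_card.
rewrite big_mkcond [leqRHS]big_mkcond /=; apply: leq_sum => v _.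
by case: (v \in Z) => //=; case: eqP => [->|] //; rewrite bB.
Qed.

(** A clique of rank t misses at least |J| - t of the classes, and all the points of these
    extend it. *)
Lemma multipartite_cliques (Z : {set V}) (J : {set I}) Q t :
  {in J, forall b, Q <= #|[set v in Z | col v == b]|}%N ->
  ('C(#|J|, t) * Q ^ t <= #|cliques e Z t|)%N.
Proof.
have e_sym : symmetric e by move=> x y; rewrite /e eq_sym.
move=> hJ; elim: t => [|t IH]; first by rewrite cliques0 bin0.
rewrite -(leq_pmul2l (ltn0Sn t)) clique_extensions // mulnA mul_bin_left.
apply: leq_trans (_ : #|cliques e Z t| * ((#|J| - t) * Q) <= _)%N.
  rewrite expnS -mulnA [('C(_, _) * _)%N]mulnCA mulnA mulnC.
  by rewrite leq_mul2r IH orbT.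
rewrite -sum_nat_const; apply: leq_sum => S; rewrite inE => /and3P[_ /eqP cS _].
apply: leq_trans (_ : #|J :\: col @: S| * Q <= _)%N.
  rewrite leq_mul2r; apply/orP; right; rewrite cardsD leq_sub2l //.
  rewrite -cS; apply: leq_trans (leq_imset_card col S).
  by apply: subset_leq_card; exact: subsetIr.
apply: leq_trans (card_color_classes (Z := Z) _) _.
  by move=> b; rewrite inE => /andP[_]; exact: hJ.
apply: subset_leq_card; apply/subsetP => v; rewrite !inE => /and3P[vZ vS _].
rewrite vZ /=; apply/andP; split; first by apply: contraNN vS => vS; exact: imset_f.
by apply/forall_inP => x xS; apply: contraNneq vS => <-; exact: imset_f.
Qed.

End Multipartite.

(** * The Lenz configuration *)

Section LenzPoints.
Variable R : realType.

(** The rational parametrisation of the circle at parameter 1 / (i + 2); these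
    points lie in the open first quadrant, and a quarter turn moves them to the
    second one. *)
Definition arc_x (i : nat) : R := (i.+2%:R ^+ 2 - 1) / (i.+2%:R ^+ 2 + 1).
Definition arc_y (i : nat) : R := 2 * i.+2%:R / (i.+2%:R ^+ 2 + 1).

Lemma arc_gt0 i : 0 < arc_x i /\ 0 < arc_y i.
Proof.
rewrite /arc_x /arc_y; have u2 : 2 <= i.+2%:R :> R by rewrite (ler_nat R 2).
move: (i.+2%:R : R) u2 => u u2; have u0 : 0 < u by lra.
have d0 : 0 < u ^+ 2 + 1 by rewrite addr_gt0 ?exprn_gt0.
split; rewrite divr_gt0 //; last by rewrite mulr_gt0.
by rewrite subr_gt0 expr_gt1 ?(ltW u0) //; lra.
Qed.

Lemma arc_unit i : arc_x i ^+ 2 + arc_y i ^+ 2 = 1.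
Proof.
rewrite /arc_x /arc_y; have : i.+2%:R ^+ 2 + 1 != 0 :> R.
  by rewrite gt_eqF // ltr_wpDl ?exprn_ge0.
by move: (i.+2%:R : R) => u hu; field.
Qed.

Lemma arc_inj i j : arc_x i = arc_x j -> i = j.
Proof.
have u0 : i.+2%:R ^+ 2 + 1 != 0 :> R by rewrite gt_eqF // ltr_wpDl ?exprn_ge0.
have v0 : j.+2%:R ^+ 2 + 1 != 0 :> R by rewrite gt_eqF // ltr_wpDl ?exprn_ge0.
rewrite /arc_x => /eqP; rewrite eqr_div // => /eqP h.
have : i.+2%:R ^+ 2 = j.+2%:R ^+ 2 :> R by move: h; lra.
by rewrite -!natrX => /eqP; rewrite eqr_nat eqn_exp2r // => /eqP[].
Qed.

(** The points 2 i and 2 i + 1 are at a right angle, and all points are distinct. *)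
Definition circ_x i := if odd i then - arc_y i./2 else arc_x i./2.
Definition circ_y i := if odd i then arc_x i./2 else arc_y i./2.

Lemma circ_unit i : circ_x i * circ_x i + circ_y i * circ_y i = 1.
Proof.
rewrite /circ_x /circ_y; have := arc_unit i./2.
by case: odd; rewrite !expr2 => <-; rewrite ?mulrNN // addrC.
Qed.

Lemma circ_inj i j : circ_x i = circ_x j -> circ_y i = circ_y j -> i = j.
Proof.
have [xi yi] := arc_gt0 i./2; have [xj yj] := arc_gt0 j./2.
rewrite /circ_x /circ_y; case oi: (odd i); case oj: (odd j) => ex ey.
- by rewrite -[i]odd_double_half -[j]odd_double_half oi oj (arc_inj ey).
- by exfalso; move: xj; rewrite -ex; lra.
- by exfalso; move: xi; rewrite ex; lra.
- by rewrite -[i]odd_double_half -[j]odd_double_half oi oj (arc_inj ex).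
Qed.

Lemma circ_orthogonal i :
  circ_x i.*2 * circ_x i.*2.+1 + circ_y i.*2 * circ_y i.*2.+1 = 0.
Proof.
rewrite /circ_x /circ_y /= odd_double /= uphalf_double doubleK; ring.
Qed.

Variable r : nat.

Definition lenz (a : 'I_r) i : 'rV[R]_(r + r) :=
  row_mx (circ_x i *: delta_mx 0 a) (circ_y i *: delta_mx 0 a).

Lemma dot_row_mx (u v u' v' : 'rV[R]_r) :
  dot (row_mx u v) (row_mx u' v') = dot u u' + dot v v'.
Proof. by rewrite /dot tr_row_mx mul_row_col mxE. Qed.

Lemma dot_delta (a b : 'I_r) : dot (delta_mx 0 a) (delta_mx 0 b) = (a == b)%:R :> R.
Proof.
rewrite dotE (bigD1 a) //= big1 ?addr0; first by rewrite !mxE !eqxx mul1r.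
by move=> i ia; rewrite !mxE (negPf ia) andbF mul0r.
Qed.

Lemma sqdist_lenz a b i j : sqdist (lenz a i) (lenz b j) =
  2 - 2 * (a == b)%:R * (circ_x i * circ_x j + circ_y i * circ_y j).
Proof.
have dotL c k c' k' : dot (lenz c k) (lenz c' k') =
    (c == c')%:R * (circ_x k * circ_x k' + circ_y k * circ_y k').
  by rewrite dot_row_mx !(dotZl, dotZr) !dot_delta; move: (_ == _)%:R => z; ring.
rewrite sqdistE !(dotBl, dotBr) !dotL !eqxx !circ_unit (eq_sym b a) /=.
move: ((a == b)%:R : R) => z; ring.
Qed.

Lemma lenz_inj a b i j : lenz a i = lenz b j -> a = b /\ i = j.
Proof.
move=> E; have : sqdist (lenz a i) (lenz b j) = 0.
  by rewrite E /sqdist big1 // => k _; rewrite subrr expr0n.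
rewrite sqdist_lenz; case: eqP => [->|_]; last by move=> /eqP; rewrite mulr0 mul0r subr0 pnatr_eq0.
rewrite mulr1 => h; split => //.
have := circ_unit i; have := circ_unit j => hj hi.
have s0 : (circ_x i - circ_x j) ^+ 2 + (circ_y i - circ_y j) ^+ 2 = 0.
  clear E; rewrite !sqrrB !expr2; lra.
move/eqP: s0; rewrite paddr_eq0 ?sqr_ge0 // !sqrf_eq0 !subr_eq0.
by move=> /andP[/eqP ex /eqP ey]; exact: circ_inj.
Qed.

End LenzPoints.

(** The configuration has s points on circle 0 and Q points on each of the m other
    circles. *)
Section LenzCount.
Variables (R : realType) (m Q s : nat).
Local Notation r := m.+1.
Let V : finType := ('I_s + 'I_m * 'I_Q)%type.

Definition lenz_label (v : V) : 'I_r * nat :=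
  match v with inl i => (ord0, val i) | inr (a, i) => (lift ord0 a, val i) end.

Definition lenz_point v := lenz R (lenz_label v).1 (lenz_label v).2.

Lemma lenz_point_inj : injective lenz_point.
Proof.
move=> [i|[a i]] [j|[b j]] /lenz_inj /= [ab ij].
- by congr inl; exact: val_inj.
- by have := neq_lift ord0 b; rewrite -ab eqxx.
- by have := neq_lift ord0 a; rewrite ab eqxx.
- by congr inr; congr pair; [exact: lift_inj ab | exact: val_inj].
Qed.

Lemma card_lenz : #|{: V}| = (s + m * Q)%N.
Proof. by rewrite card_sum card_prod !card_ord. Qed.

Let D v w := sqdist (lenz_point v) (lenz_point w).
Let col v := (lenz_label v).1.
Let Z : {set V} := [set v | if v is inr _ then true else false].

Lemma lenz_dist_col v w : col v != col w -> D v w = 2.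
Proof. by move=> vw; rewrite /D sqdist_lenz (negPf vw) mulr0 mul0r subr0. Qed.

Lemma half_lt (i : 'I_(s./2)) : (i.*2.+1 < s)%N.
Proof. have := ltn_ord i; have := odd_double_half s; lia. Qed.

Definition pair_lo i : 'I_s := Ordinal (ltnW (half_lt i)).
Definition pair_hi i : 'I_s := Ordinal (half_lt i).

(** Traces on circle 0 of the simplices that are counted: nothing, a point, or two
    points at a right angle. *)
Definition trace (i : unit + ('I_s + 'I_(s./2))) : {set V} :=
  match i with
  | inl _ => set0
  | inr (inl j) => [set inl j]
  | inr (inr j) => [set inl (pair_lo j); inl (pair_hi j)]
  end.

Definition trace_size (i : unit + ('I_s + 'I_(s./2))) :=
  match i with inl _ => 0%N | inr (inl _) => 1%N | inr (inr _) => 2%N end.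

Lemma card_trace i : #|trace i| = trace_size i.
Proof.
case: i => [_|[j|j]] /=; rewrite ?cards0 ?cards1 ?cards2 //.
by rewrite (inj_eq (@inl_inj _ _)) -val_eqE /= neq_ltn ltnSn.
Qed.

Lemma trace_inj : injective trace.
Proof.
move=> i j E; have := congr1 (fun A : {set V} => #|A|) E; rewrite /= !card_trace.
case: i E => [[]|[i|i]]; case: j => [[]|[j|j]] //= E _.
  have : (inl i : V) \in [set inl j] by rewrite -E set11.
  by rewrite inE => /eqP[->].
have : (inl (pair_lo i) : V) \in [set inl (pair_lo j); inl (pair_hi j)].
  by rewrite -E set21.
rewrite !inE !(inj_eq (@inl_inj _ _)) -!val_eqE /= => /orP[/eqP/double_inj ij|/eqP ij].
  by congr (inr (inr _)); exact: val_inj.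
by have := congr1 odd ij; rewrite /= !odd_double.
Qed.

Lemma trace_first i v : v \in trace i -> exists j, v = inl j.
Proof.
case: i => [_|[j|j]] /=; rewrite !inE //; first by move/eqP->; exists j.
by case/orP => /eqP->; eexists.
Qed.

Lemma trace_dist i : {in trace i &, forall x y, x != y -> D x y = 2}.
Proof.
case: i => [_|[j|j]] x y /=; rewrite !inE //.
  by move=> /eqP-> /eqP->; rewrite eqxx.
have orth : D (inl (pair_lo j)) (inl (pair_hi j)) = 2.
  by rewrite /D sqdist_lenz /= circ_orthogonal mulr0 subr0.
move=> /orP[]/eqP-> /orP[]/eqP->; rewrite ?eqxx // => _.
by rewrite /D sqdist_sym.
Qed.

Let K t := #|cliques (fun x y => col x != col y) Z t|.

Lemma lenz_cliques t : ('C(m, t) * Q ^ t <= K t)%N.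
Proof.
pose J := [set~ (ord0 : 'I_r)].
have cJ : #|J| = m by rewrite cardsC1 card_ord.
rewrite -{1}cJ; apply: multipartite_cliques => b; rewrite !inE => b0.
case: (unliftP ord0 b) b0 => [a ->|->]; rewrite ?eqxx // => _.
rewrite -[leqLHS]card_ord -(card_imset (f := fun i : 'I_Q => inr (a, i) : V)) //; last first.
  by move=> i i' [].
apply: subset_leq_card; apply/subsetP => _ /imsetP[i _ ->]; rewrite !inE /col /=.
by rewrite eqxx.
Qed.

Lemma lenz_simplices q :
  (K q.+2 + s * K q.+1 + s./2 * K q <= #|simplices D q.+2|)%N.
Proof.
pose P := [set u : (unit + ('I_s + 'I_(s./2))) * {set V} |
   u.2 \in cliques (fun x y => col x != col y) Z (q.+2 - trace_size u.1)%N].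
have cP : #|P| = (K q.+2 + s * K q.+1 + s./2 * K q)%N.
  rewrite -sum1dep_card -(pair_big_dep xpredT
    (fun i S => S \in cliques (fun x y => col x != col y) Z (q.+2 - trace_size i)%N) (fun _ _ => 1%N)) /=.
  under eq_bigr do rewrite sum1_card.
  rewrite !big_sumType /= !sum_nat_const !card_ord card_unit mul1n !subn0 addnA.
  by rewrite subn1 subn2.
have split u : u \in P -> [/\ u.2 \subset Z, #|u.2| = (q.+2 - trace_size u.1)%N,
    {in u.2 &, forall x y, x != y -> D x y = 2},
    trace u.1 = (trace u.1 :|: u.2) :\: Z & u.2 = (trace u.1 :|: u.2) :&: Z].
  rewrite !inE => /and3P[SZ /eqP cS /is_cliqueP cl].
  have tZ v : v \in trace u.1 -> v \notin Z by move/trace_first => [j ->]; rewrite inE.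
  split => //.
  - by move=> x y xS yS xy; apply: lenz_dist_col; exact: cl.
  - apply/setP => v; rewrite !in_setD in_setU.
    case: (boolP (v \in trace u.1)) => [/tZ ->//|_] /=.
    by apply/esym/negP => /andP[+ vS]; rewrite (subsetP SZ).
  - apply/setP => v; rewrite in_setI in_setU.
    case: (boolP (v \in u.2)) => [/(subsetP SZ) ->|_]; rewrite ?orbT ?orbF //.
    by apply/esym/negP => /andP[/tZ/negP].
rewrite -cP -(card_in_imset (f := fun u => trace u.1 :|: u.2)); last first.
  move=> u u' /split[_ _ _ e1 e2] /split[_ _ _ e1' e2'] E.
  rewrite [u]surjective_pairing [u']surjective_pairing; congr pair.
    by apply: trace_inj; rewrite e1 e1' E.
  by rewrite e2 e2' E.
apply: subset_leq_card; apply/subsetP => _ /imsetP[u /split[SZ cS dS _ _] ->].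
have tZ v : v \in trace u.1 -> v \notin Z by move/trace_first => [j ->]; rewrite inE.
apply/simplicesP; split.
  rewrite cardsU card_trace cS (_ : _ :&: _ = set0) ?cards0 ?subn0.
    by rewrite subnKC //; case: (u.1) => [?|[?|?]].
  apply/setP => v; rewrite !inE; apply/negP => /andP[/tZ/negP h /(subsetP SZ)].
  exact: h.
have cross x y : x \in trace u.1 -> y \in u.2 -> D x y = 2.
  move=> /trace_first[j ->] /(subsetP SZ); rewrite inE; case: y => [//|[a i] _].
  by apply: lenz_dist_col; exact: (neq_lift ord0 a).
exists 2 => x y /setUP[xt|xS] /setUP[yt|yS] xy.
- exact: trace_dist xt yt xy.
- exact: cross.
- by rewrite /D sqdist_sym; exact: cross.
- exact: dS xS yS xy.
Qed.

End LenzCount.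

(** * The asymptotic formula *)

(** For n = Q r + j, the main term (Q + j/r)^k differs from its first two terms at Q by
    O(Q^(k-2)), which is less than the number of the additional simplices. *)
Lemma exprD_le_second_order (R : realFieldType) (y x : R) s : 1 <= y -> 0 <= x <= 1 ->
  (y + x) ^+ s.+2 <= y ^+ s.+2 + s.+2%:R * x * y ^+ s.+1 + 4 ^+ s.+2 * y ^+ s.
Proof.
move=> y1 /andP[x0 x1]; have y0 : 0 <= y by apply: le_trans y1.
elim: s => [|s IH].
  have : x ^+ 2 <= 1 by rewrite expr_le1.
  by rewrite expr0 expr1 mulr1 sqrrD mulr2n; lra.
rewrite exprS; apply: le_trans (ler_wpM2l (addr_ge0 y0 x0) IH) _.
have s4 : s.+2%:R <= 4 ^+ s.+2 :> R.
  by rewrite -natrX ler_nat ltnW // ltn_expl.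
rewrite [y ^+ s.+3]exprS [y ^+ s.+2]exprS [y ^+ s.+1]exprS [4 ^+ s.+3]exprS.
have -> : s.+3%:R = s.+2%:R + 1 :> R by rewrite natr1.
have ys : 0 <= y ^+ s by rewrite exprn_ge0.
have S0 : 0 <= s.+2%:R :> R by [].
move: s4 S0 ys; move: (s.+2%:R : R) (4 ^+ s.+2 : R) (y ^+ s) => a b z ab a0 z0.
have x2 : x ^+ 2 <= 1 by rewrite expr_le1.
rewrite -subr_ge0.
have -> : y * (y * (y * z)) + (a + 1) * x * (y * (y * z)) + 4 * b * (y * z) -
    (y + x) * (y * (y * z) + a * x * (y * z) + b * z) =
    (y * z) * (3 * b - a * x ^+ 2) - x * (b * z) by ring.
have h1 : x * (b * z) <= (y * z) * b.
  rewrite [leRHS]mulrAC -mulrA; apply: ler_wpM2r; last exact: le_trans y1.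
  by rewrite mulr_ge0 //; apply: le_trans ab.
have h2 : a * x ^+ 2 <= a by rewrite ler_piMr.
have h3 : 0 <= (y * z) * (2 * b - a * x ^+ 2).
  by rewrite !mulr_ge0 //; move: ab a0 h2; lra.
by rewrite mulrBr in h3 *; move: h1 h3; lra.
Qed.

(** All the remainder n mod r goes to circle 0: the j extra points contribute exactly the
    first order term j C(m, q) Q^q, and the right angles on circle 0 the surplus. *)
Lemma max_simplices_lower (R : realType) m q : (1 < q <= m)%N ->
  exists2 c : R, 0 < c & exists N, forall n, (N <= n)%N ->
    (exists A : {fset 'rV[R]_(m.+1 + m.+1)}, #|` A| = n) /\
    'C(m.+1, q.+1)%:R * (n%:R / m.+1%:R) ^+ q.+1 + c * n%:R ^+ q <=
      (max_simplices R (m.+1 + m.+1) q.+1 n)%:R :> R.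
Proof.
case: q => [|q] /andP[q1 qm]; first by [].
set r := m.+1.
have rR : 0 < r%:R :> R by rewrite ltr0n.
pose B : R := 'C(r, q.+2)%:R * 4 ^+ q.+2.
have [N1 N1P] := upper_nat (4 * B + 2).
exists (4^-1 / (2 * r%:R) ^+ q.+1); first by rewrite divr_gt0 ?invr_gt0 // exprn_gt0 // mulr_gt0.
exists (r * maxn 1 N1)%N => n Nn.
pose Q := (n %/ r)%N; pose j := (n %% r)%N.
have nE : n = (Q * r + j)%N by exact: divn_eq.
have jr : (j < r)%N by rewrite ltn_mod.
have : (maxn 1 N1 <= Q)%N by rewrite leq_divRL // mulnC.
rewrite geq_max => /andP[Q1 QN].
pose s := (Q + j)%N.
pose A := [fset lenz_point R v | v in {: 'I_s + 'I_m * 'I_Q}]%fset.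
have cA : #|` A| = n.
  rewrite card_imfset; last exact: lenz_point_inj.
  by rewrite -cardE card_lenz nE /s /r; lia.
split; first by exists A.
apply: le_trans (_ : (num_simplices q.+2 A)%:R <= _); last first.
  by rewrite ler_nat; exact: num_simplices_le_max.
pose D (v w : 'I_s + 'I_m * 'I_Q) := sqdist (lenz_point R v) (lenz_point R w).
apply: le_trans (_ : #|simplices D q.+2|%:R <= _); last first.
  by rewrite ler_nat; apply: num_simplices_ge; exact: lenz_point_inj.
have count : ('C(r, q.+2) * Q ^ q.+2 + j * 'C(m, q.+1) * Q ^ q.+1 + s./2 * Q ^ q <=
    #|simplices D q.+2|)%N.
  apply: leq_trans (lenz_simplices R m Q s q).
  have h t := @lenz_cliques m Q s t.
  apply: leq_trans (leq_add (leq_add (h q.+2) (leq_mul (leqnn s) (h q.+1)))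
    (leq_mul (leqnn s./2) (h q))).
  apply: leq_add; last first.
    by rewrite leq_mul2l leq_pmull ?orbT // bin_gt0 ltnW // ltnW.
  by rewrite /r binS /s expnS !mulnDl; move: ('C(m, q.+2) * _)%N => *; nia.
apply: le_trans (_ : ('C(r, q.+2) * Q ^ q.+2 + j * 'C(m, q.+1) * Q ^ q.+1 + s./2 * Q ^ q)%:R <= _);
  last by rewrite ler_nat.
pose y : R := Q%:R; pose x : R := j%:R / r%:R.
have y1 : 1 <= y by rewrite (ler_nat R 1).
have x01 : 0 <= x <= 1 by rewrite divr_ge0 // ler_pdivrMr // mul1r ler_nat ltnW.
have nrE : n%:R / r%:R = y + x.
  by rewrite {1}nE natrD natrM mulrDl mulfK // gt_eqF.
rewrite nrE natrD natrD !natrM !natrX -/y.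
have yq : 0 <= y ^+ q by rewrite exprn_ge0 // (le_trans _ y1).
have e1 := ler_wpM2l (ler0n R 'C(r, q.+2)) (exprD_le_second_order q y1 x01).
have e2 : 'C(r, q.+2)%:R * (q.+2%:R * x * y ^+ q.+1) = j%:R * 'C(m, q.+1)%:R * y ^+ q.+1.
  have diag : 'C(r, q.+2)%:R * q.+2%:R = r%:R * 'C(m, q.+1)%:R :> R.
    by rewrite -!natrM mulnC -mul_bin_diag.
  rewrite !mulrA diag /x; congr (_ * _).
  by rewrite -[X in X / _]mulrA mulrC mulKf ?gt_eqF // mulrC.
have e3 : 4^-1 / (2 * r%:R) ^+ q.+1 * n%:R ^+ q.+1 <= 4^-1 * y * y ^+ q.
  rewrite -mulrA -[4^-1 * y * _]mulrA ler_wpM2l ?invr_ge0 // -exprS mulrC -expr_div_n.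
  have nr : n%:R / (2 * r%:R) <= y.
    rewrite ler_pdivrMr; last exact: mulr_gt0.
    rewrite -[n%:R](divfK (lt0r_neq0 rR)) nrE mulrA ler_wpM2r //.
    by move: x01 y1 => /andP[_]; lra.
  apply: lerXn2r => //; rewrite nnegrE; last exact: le_trans y1.
  by rewrite divr_ge0 // mulr_ge0.
have e4 : 4^-1 * y * y ^+ q + B * y ^+ q <= s./2%:R * y ^+ q.
  rewrite -mulrDl ler_wpM2r //.
  have : Q%:R <= 2 * s./2%:R + 1 :> R.
    rewrite -natrM natr1 ler_nat; have := odd_double_half s; rewrite /s.
    by move: (odd _) => b; case: b => /=; lia.
  have := N1P _ QN; rewrite -/y; lra.
rewrite !mulrDr e2 in e1.
have e5 : 'C(r, q.+2)%:R * (4 ^+ q.+2 * y ^+ q) = B * y ^+ q by rewrite mulrA.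
rewrite e5 in e1.
apply: le_trans (lerD e1 e3) _; rewrite -!addrA lerD2l lerD2l [leLHS]addrC; exact: e4.
Qed.

Theorem corollary6 (R : realType) (r k : nat) (hk : (3 <= k)%N) (hr : (k <= r)%N) :
  exists (c C : R) (N : nat),
    0 < c /\ 0 < C /\
    forall n : nat, (N <= n)%N ->
      let err := (max_simplices R (2 * r) k n)%:R
                 - 'C(r, k)%:R * (n%:R / r%:R) ^+ k in
      c * n%:R ^+ k.-1 <= err /\ err <= C * n%:R ^+ k.-1.
Proof.
rewrite mul2n -addnn.
case: k hk hr => [//|q]; rewrite ltnS => q1.
case: r => [//|m]; rewrite ltnS => qm.
have q1m : (1 < q <= m)%N by rewrite q1.
have [c c0 [N cP]] := max_simplices_lower R q1m.
have [C C0 CP] := simplices_upper R q1m.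
exists c, C, N; split => //; split => // n Nn /=.
have [[A cA] low] := cP n Nn; split; first by rewrite lerBrDl.
rewrite lerBlDl; have [B cB <-] := max_simplices_attained q.+1 cA.
apply: le_trans (_ : #|simplices (fun x y : B => sqdist (val x) (val y)) q.+1|%:R <= _).
  by rewrite ler_nat num_simplices_le.
by have := CP B val val_inj; rewrite -cardfE cB.
Qed.
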